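(* Let $R$ be a local noetherian factorial domain, let $U_1,\ldots,U_r$ be (pairwise) non-associated prime elements of $R$, let $f=U_1^{d_1}\cdots U_r^{d_r}$ with $d_i>0$, and let $A=R[X,Y]/(XY-f)$. Let $D$ be a Weil divisor of $A$. Then the following are equivalent. (i) A (nonzero) multiple of $D$ is principal. (ii) $D$ is strongly coaffine. (iii) $D$ is affine trivial. Moreover, the affine class group $ACl\, A$ is $Cl\, A$ modulo torsion.
   Context: A normal scheme means a noetherian separated irreducible reduced normal scheme. A divisor is a Weil divisor; it is called trivial if it is principal. The complement of an effective divisor is the complement of its support. Let $X$ be a normal scheme. A divisor $D$ on $X$ is coaffine if for every effective divisor $E$ linearly equivalent to $D$ the complement of $E$ is an affine scheme. $D$ is strongly coaffine if for every $n\in\mathbb{Z}$ the divisor $nD$ is coaffine or trivial. $D$ is affine trivial if for every strongly coaffine divisor $E$ the divisor $D+E$ is again strongly coaffine. The affine trivial divisors form a subgroup of $\operatorname{Div} X$ containing the principal divisors; the affine class group $ACl\, X$ is the group of divisors modulo the affine trivial divisors (a quotient of the divisor class group $Cl\, X$). For a normal noetherian domain $A$ put $Cl\, A=Cl(\operatorname{Spec} A)$ and $ACl\, A = ACl(\operatorname{Spec} A)$; divisors of $A$ are divisors on $\operatorname{Spec} A$. The ring $A=R[X,Y]/(XY-f)$ is a normal noetherian domain. That $ACl\, A$ is $Cl\, A$ modulo torsion means that the kernel of $Cl\, A\to ACl\, A$ is the torsion subgroup. *)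

(* Defs.v *)
From HB Require Import structures.
From mathcomp Require Import all_boot all_order all_algebra ring_quotient.
From mathcomp Require Import generic_quotient.
From mathcomp Require Import all_classical topology freeg.
From mathcomp Require Import ring.

Set Implicit Arguments.
Unset Strict Implicit.
Unset Printing Implicit Defensive.

Import GRing.Theory.
Local Open Scope classical_set_scope.
Local Open Scope quotient_scope.
Local Open Scope ring_scope.

Definition is_ideal (A : comPzRingType) (I : set A) : Prop :=
  [/\ I 0, forall x y, I x -> I y -> I (x + y) & forall a x, I x -> I (a * x)].

Definition noetherian_ring (A : comPzRingType) : Prop :=
  forall I : set A, is_ideal I ->
    exists (n : nat) (g : 'I_n -> A),
      I = [set x | exists c : 'I_n -> A, x = \sum_(i < n) c i * g i].

Definition is_maximal_ideal (A : comPzRingType) (M : set A) : Prop :=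
  [/\ is_ideal M, ~ M 1 &
      forall J : set A, is_ideal J -> ~ J 1 -> M `<=` J -> J = M].

Definition local_ring (A : comPzRingType) : Prop :=
  exists! M : set A, is_maximal_ideal M.

Section Factorial.
Variable R : idomainType.

Definition divides (a b : R) : Prop := exists c, b = c * a.

Definition associated (a b : R) : Prop :=
  exists2 u, u \is a GRing.unit & b = u * a.

Definition irreducible_elt (p : R) : Prop :=
  [/\ p != 0, p \isn't a GRing.unit &
      forall a b, p = a * b -> (a \is a GRing.unit) || (b \is a GRing.unit)].

Definition prime_elt (p : R) : Prop :=
  [/\ p != 0, p \isn't a GRing.unit &
      forall a b, divides p (a * b) -> divides p a \/ divides p b].

Definition factorial_domain : Prop :=
  (forall a : R, a != 0 -> a \isn't a GRing.unit ->
     exists2 s : seq R, (forall p, p \in s -> irreducible_elt p) &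
                        a = \prod_(p <- s) p) /\
  (forall s t : seq R,
     (forall p, p \in s -> irreducible_elt p) ->
     (forall p, p \in t -> irreducible_elt p) ->
     associated (\prod_(p <- s) p) (\prod_(p <- t) p) ->
     exists t' : seq R, [/\ perm_eq t t', size s = size t' &
       forall i, (i < size s)%N -> associated s`_i t'`_i]).

End Factorial.

Record mulset (A : comPzRingType) := MulSet {
  ms_mem :> A -> Prop;
  mulset1 : ms_mem 1;
  mulsetM : forall s t, ms_mem s -> ms_mem t -> ms_mem (s * t)
}.

Section Localization.
Variables (A : comPzRingType) (S : mulset A).

Record preloc := PreLoc { pl_num : A; pl_den : A; pl_denP : S pl_den }.
HB.instance Definition _ := gen_eqMixin preloc.
HB.instance Definition _ := gen_choiceMixin preloc.

Definition preloc_equiv (x y : preloc) : bool :=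
  `[< exists2 w, S w & w * (pl_num x * pl_den y) = w * (pl_num y * pl_den x) >].

Lemma preloc_equiv_refl : reflexive preloc_equiv.
Proof. by move=> x; apply/asboolP; exists 1 => //; exact: mulset1. Qed.

Lemma preloc_equiv_sym : symmetric preloc_equiv.
Proof.
by move=> x y; apply/asboolP/asboolP => -[w Sw e]; exists w.
Qed.

Lemma preloc_equiv_trans : transitive preloc_equiv.
Proof.
move=> y x z /asboolP[v Sv e] /asboolP[w Sw e']; apply/asboolP.
exists (v * w * pl_den y).
  by apply: mulsetM; [exact: mulsetM | exact: pl_denP].
transitivity (w * pl_den z * (v * (pl_num x * pl_den y))); first by ring.
rewrite e; transitivity (v * pl_den x * (w * (pl_num y * pl_den z))); first by ring.
by rewrite e'; ring.
Qed.

Canonical preloc_equivRel :=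
  EquivRel preloc_equiv preloc_equiv_refl preloc_equiv_sym preloc_equiv_trans.
Canonical preloc_encModRel := defaultEncModRel preloc_equiv.

Definition loc := {eq_quot preloc_equiv}.
HB.instance Definition _ : EqQuotient preloc preloc_equiv loc := EqQuotient.on loc.
HB.instance Definition _ := Choice.on loc.

Definition frac (a s : A) (hs : S s) : loc := \pi_loc (PreLoc a hs).

Lemma frac_eqP a s (hs : S s) b t (ht : S t) :
  frac a hs = frac b ht <-> exists2 w, S w & w * (a * t) = w * (b * s).
Proof. by split=> [/eqmodP/asboolP|?] //; apply/eqmodP/asboolP. Qed.

Lemma fracP (x : loc) : exists a s (hs : S s), x = frac a hs.
Proof.
case e : (repr x) => [a s hs]; exists a, s, hs.
by rewrite /frac -e reprK.
Qed.

Definition loc0 : loc := frac 0 (mulset1 S).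
Definition loc1 : loc := frac 1 (mulset1 S).
Definition loc_opp (x : loc) : loc :=
  let: PreLoc a s hs := repr x in frac (- a) hs.
Definition loc_add (x y : loc) : loc :=
  let: PreLoc a s hs := repr x in let: PreLoc b t ht := repr y in
  frac (a * t + b * s) (mulsetM hs ht).
Definition loc_mul (x y : loc) : loc :=
  let: PreLoc a s hs := repr x in let: PreLoc b t ht := repr y in
  frac (a * b) (mulsetM hs ht).

Lemma repr_frac a s (hs : S s) : exists b t (ht : S t),
  repr (frac a hs) = PreLoc b ht /\
  exists2 w, S w & w * (b * s) = w * (a * t).
Proof.
case e : (repr (frac a hs)) => [b t ht]; exists b, t, ht; split=> //.
by apply/frac_eqP; rewrite /frac -e reprK.
Qed.

Lemma frac_opp a s (hs : S s) : loc_opp (frac a hs) = frac (- a) hs.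
Proof.
rewrite /loc_opp; have [b [t [ht [-> [w Sw e]]]]] := repr_frac a hs.
by apply/frac_eqP; exists w => //; rewrite !mulNr !mulrN e.
Qed.

Lemma frac_add a s (hs : S s) b t (ht : S t) :
  loc_add (frac a hs) (frac b ht) = frac (a * t + b * s) (mulsetM hs ht).
Proof.
rewrite /loc_add; have [a' [s' [hs' [-> [w Sw e]]]]] := repr_frac a hs.
have [b' [t' [ht' [-> [v Sv e']]]]] := repr_frac b ht.
apply/frac_eqP; exists (w * v); first exact: mulsetM.
transitivity (v * t * t' * (w * (a' * s)) + w * s * s' * (v * (b' * t))); first by ring.
by rewrite e e'; ring.
Qed.

Lemma frac_mul a s (hs : S s) b t (ht : S t) :
  loc_mul (frac a hs) (frac b ht) = frac (a * b) (mulsetM hs ht).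
Proof.
rewrite /loc_mul; have [a' [s' [hs' [-> [w Sw e]]]]] := repr_frac a hs.
have [b' [t' [ht' [-> [v Sv e']]]]] := repr_frac b ht.
apply/frac_eqP; exists (w * v); first exact: mulsetM.
transitivity ((w * (a' * s)) * (v * (b' * t))); first by ring.
by rewrite e e'; ring.
Qed.

Let eq_frac a s (hs : S s) b t (ht : S t) :
  a * t = b * s -> frac a hs = frac b ht.
Proof. by move=> e; apply/frac_eqP; exists 1; [exact: mulset1 | rewrite e]. Qed.

Lemma loc_addA : associative loc_add.
Proof.
move=> x y z; have [a [s [hs ->]]] := fracP x; have [b [t [ht ->]]] := fracP y.
have [c [u [hu ->]]] := fracP z; rewrite !frac_add; apply: eq_frac; ring.
Qed.

Lemma loc_addC : commutative loc_add.
Proof.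
move=> x y; have [a [s [hs ->]]] := fracP x; have [b [t [ht ->]]] := fracP y.
rewrite !frac_add; apply: eq_frac; ring.
Qed.

Lemma loc_add0 : left_id loc0 loc_add.
Proof.
by move=> x; have [a [s [hs ->]]] := fracP x; rewrite frac_add; apply: eq_frac; ring.
Qed.

Lemma loc_addN : left_inverse loc0 loc_opp loc_add.
Proof.
move=> x; have [a [s [hs ->]]] := fracP x.
by rewrite frac_opp frac_add; apply: eq_frac; ring.
Qed.

HB.instance Definition _ :=
  GRing.isZmodule.Build loc loc_addA loc_addC loc_add0 loc_addN.

Lemma loc_mulA : associative loc_mul.
Proof.
move=> x y z; have [a [s [hs ->]]] := fracP x; have [b [t [ht ->]]] := fracP y.
have [c [u [hu ->]]] := fracP z; rewrite !frac_mul; apply: eq_frac; ring.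
Qed.

Lemma loc_mulC : commutative loc_mul.
Proof.
move=> x y; have [a [s [hs ->]]] := fracP x; have [b [t [ht ->]]] := fracP y.
rewrite !frac_mul; apply: eq_frac; ring.
Qed.

Lemma loc_mul1 : left_id loc1 loc_mul.
Proof.
by move=> x; have [a [s [hs ->]]] := fracP x; rewrite frac_mul; apply: eq_frac; ring.
Qed.

Lemma loc_mulD : left_distributive loc_mul +%R.
Proof.
move=> x y z; have [a [s [hs ->]]] := fracP x; have [b [t [ht ->]]] := fracP y.
have [c [u [hu ->]]] := fracP z.
by rewrite [_ + _]frac_add !frac_mul [RHS]frac_add; apply: eq_frac; ring.
Qed.

HB.instance Definition _ :=
  GRing.Zmodule_isComPzRing.Build loc loc_mulA loc_mulC loc_mul1 loc_mulD.

Lemma fracD a s (hs : S s) b t (ht : S t) :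
  frac a hs + frac b ht = frac (a * t + b * s) (mulsetM hs ht).
Proof. exact: frac_add. Qed.

Lemma fracN a s (hs : S s) : - frac a hs = frac (- a) hs.
Proof. exact: frac_opp. Qed.

Lemma fracM a s (hs : S s) b t (ht : S t) :
  frac a hs * frac b ht = frac (a * b) (mulsetM hs ht).
Proof. exact: frac_mul. Qed.

Lemma frac0 s (hs : S s) : frac 0 hs = 0.
Proof. by apply: eq_frac; rewrite !mul0r. Qed.

Lemma frac1 s (hs : S s) : frac s hs = 1.
Proof. by apply: eq_frac; rewrite mulrC. Qed.

Definition to_loc (a : A) : loc := frac a (mulset1 S).

End Localization.

Record spec (A : comPzRingType) := Spec {
  pset :> A -> Prop;
  pset_ideal : is_ideal pset;
  pset_proper : ~ pset 1;
  pset_prime : forall a b, pset (a * b) -> pset a \/ pset b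
}.

HB.instance Definition _ A := gen_eqMixin (spec A).
HB.instance Definition _ A := gen_choiceMixin (spec A).

Section Zariski.
Variable A : comPzRingType.

Definition zariski_open (U : set (spec A)) : Prop :=
  exists T : set A, U = [set P | ~ (T `<=` pset P)].

Lemma zariski_openT : zariski_open setT.
Proof.
exists [set 1]; apply/seteqP; split=> // P _ /= sP; exact: (pset_proper (sP 1 erefl)).
Qed.

Lemma zariski_openI : setI_closed zariski_open.
Proof.
move=> _ _ [S ->] [T ->].
exists [set x | exists s t, [/\ S s, T t & x = s * t]]; apply/seteqP; split=> P /=.
  move=> [nS nT] sP.
  have [s [Ss Ps]] : exists s, S s /\ ~ P s.
    by apply: contrapT => h; apply: nS => s Ss; apply: contrapT => Ps; apply: h; exists s.
  have [t [Tt Pt]] : exists t, T t /\ ~ P t.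
    by apply: contrapT => h; apply: nT => t Tt; apply: contrapT => Pt; apply: h; exists t.
  by case: (@pset_prime _ P s t) => //; apply: sP; exists s, t.
have [_ _ PM] := pset_ideal P.
move=> n; split=> h; apply: n => _ [s [t [Ss Tt ->]]].
  by rewrite mulrC; apply: PM; exact: h.
by apply: PM; exact: h.
Qed.

Lemma zariski_open_bigU (I : Type) (f : I -> set (spec A)) :
  (forall i, zariski_open (f i)) -> zariski_open (\bigcup_i f i).
Proof.
move=> /choice[T fT]; exists (\bigcup_i T i); apply/seteqP; split=> P /=.
  by move=> [i _]; rewrite fT /= => n sP; apply: n => x Tx; apply: sP; exists i.
move=> n; apply: contrapT => h; apply: n => x [i _ Tx].
apply: contrapT => Px; apply: h; exists i => //; rewrite fT /= => sP.
exact: Px (sP x Tx).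
Qed.

HB.instance Definition _ := isOpenTopological.Build (spec A)
  zariski_openT zariski_openI zariski_open_bigU.

Lemma prime_compl_subproof1 (P : spec A) : ~ P 1.
Proof. exact: pset_proper. Qed.

Lemma prime_compl_subproofM (P : spec A) s t : ~ P s -> ~ P t -> ~ P (s * t).
Proof. by move=> nS nT /pset_prime[]. Qed.

Definition prime_compl (P : spec A) : mulset A :=
  MulSet (@prime_compl_subproof1 P) (@prime_compl_subproofM P).

Definition stalk (P : spec A) := loc (prime_compl P).
HB.instance Definition _ P := GRing.ComPzRing.on (stalk P).

End Zariski.

Section StructureSheaf.
Variable A : comPzRingType.

(* A section over an open set U is a family of elements of the local rings A_P,
   P in U, that near every point of U is given by a single fraction a / g. *)
Definition locally_fraction (U : set (spec A))
    (s : forall P : spec A, U P -> stalk P) : Prop :=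
  forall P, U P -> exists (V : set (spec A)) (a g : A),
    [/\ open V, V P &
        forall Q (hQ : U Q), V Q ->
          exists hg : prime_compl Q g, s Q hQ = frac a hg].

Record sections (U : set (spec A)) := Sections {
  sec_fun :> forall P : spec A, U P -> stalk P;
  sec_locally : locally_fraction sec_fun
}.

HB.instance Definition _ U := gen_eqMixin (sections U).
HB.instance Definition _ U := gen_choiceMixin (sections U).

Section SectionRing.
Variable U : set (spec A).

Lemma sec_ext (s t : sections U) : (forall P (h : U P), s P h = t P h) -> s = t.
Proof.
case: s t => [s hs] [t ht] /= e.
have est : s = t.
  by apply: functional_extensionality_dep => P; apply: functional_extensionality_dep.
by case: _ / est ht => ht; congr Sections; exact: Prop_irrelevance.
Qed.

Let locally_fraction2 (f : forall P : spec A, stalk P -> stalk P -> stalk P)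
    (num den : A -> A -> A -> A -> A) :
  (forall P a (g : A) (hg : prime_compl P g) b (k : A) (hk : prime_compl P k),
     exists hd : prime_compl P (den a g b k),
     f P (frac a hg) (frac b hk) = frac (num a g b k) hd) ->
  forall s t : sections U, locally_fraction (fun P (h : U P) => f P (s P h) (t P h)).
Proof.
move=> hf s t P UP; have [V [a [g [oV VP hs]]]] := sec_locally s UP.
have [W [b [k [oW WP ht]]]] := sec_locally t UP.
exists (V `&` W), (num a g b k), (den a g b k); split=> //; first exact: openI.
move=> Q hQ [VQ WQ]; have [hg ->] := hs Q hQ VQ; have [hk ->] := ht Q hQ WQ.
exact: hf.
Qed.

Let sec_cst_subproof (a : A) :
  locally_fraction (fun (P : spec A) (_ : U P) => to_loc (prime_compl P) a).
Proof.
move=> P _; exists setT, a, 1; split=> //; first exact: openT.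
by move=> Q _ _; exists (mulset1 (prime_compl Q)).
Qed.

Let sec_add_subproof (s t : sections U) :
  locally_fraction (fun P (h : U P) => s P h + t P h).
Proof.
apply: (locally_fraction2 (f := fun P => +%R) (num := fun a g b k => a * k + b * g)
  (den := fun a g b k => g * k)) => P a g hg b k hk.
by exists (mulsetM hg hk); rewrite fracD.
Qed.

Let sec_mul_subproof (s t : sections U) :
  locally_fraction (fun P (h : U P) => s P h * t P h).
Proof.
apply: (locally_fraction2 (f := fun P => *%R) (num := fun a g b k => a * b)
  (den := fun a g b k => g * k)) => P a g hg b k hk.
by exists (mulsetM hg hk); rewrite fracM.
Qed.

Let sec_opp_subproof (s : sections U) :
  locally_fraction (fun P (h : U P) => - s P h).
Proof.
apply: (locally_fraction2 (f := fun P x _ => - x) (num := fun a g b k => - a)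
  (den := fun a g b k => g) _ s s) => P a g hg b k hk.
by exists hg; rewrite fracN.
Qed.

Definition sec_cst (a : A) : sections U := Sections (sec_cst_subproof a).
Definition sec_add (s t : sections U) : sections U := Sections (sec_add_subproof s t).
Definition sec_mul (s t : sections U) : sections U := Sections (sec_mul_subproof s t).
Definition sec_opp (s : sections U) : sections U := Sections (sec_opp_subproof s).

Let sec_addA : associative sec_add.
Proof. by move=> s t u; apply: sec_ext => P h; exact: addrA. Qed.
Let sec_addC : commutative sec_add.
Proof. by move=> s t; apply: sec_ext => P h; exact: addrC. Qed.
Let sec_add0 : left_id (sec_cst 0) sec_add.
Proof. by move=> s; apply: sec_ext => P h /=; exact: add0r. Qed.
Let sec_addN : left_inverse (sec_cst 0) sec_opp sec_add.
Proof. by move=> s; apply: sec_ext => P h /=; exact: addNr. Qed.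
Let sec_mulA : associative sec_mul.
Proof. by move=> s t u; apply: sec_ext => P h; exact: mulrA. Qed.
Let sec_mulC : commutative sec_mul.
Proof. by move=> s t; apply: sec_ext => P h; exact: mulrC. Qed.
Let sec_mul1 : left_id (sec_cst 1) sec_mul.
Proof. by move=> s; apply: sec_ext => P h /=; exact: mul1r. Qed.
Let sec_mulD : left_distributive sec_mul sec_add.
Proof. by move=> s t u; apply: sec_ext => P h; exact: mulrDl. Qed.

HB.instance Definition _ :=
  GRing.isZmodule.Build (sections U) sec_addA sec_addC sec_add0 sec_addN.
HB.instance Definition _ :=
  GRing.Zmodule_isComPzRing.Build (sections U) sec_mulA sec_mulC sec_mul1 sec_mulD.

End SectionRing.

Lemma sec_res_subproof (U V : set (spec A)) (sub : V `<=` U) (s : sections U) :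
  locally_fraction (fun P (h : V P) => s P (sub P h)).
Proof.
move=> P VP; have [W [a [g [oW WP hs]]]] := sec_locally s (sub P VP).
by exists W, a, g; split=> // Q hQ; exact: hs.
Qed.

Definition sec_res (U V : set (spec A)) (sub : V `<=` U) (s : sections U) :
  sections V := Sections (sec_res_subproof sub s).

End StructureSheaf.

(* The open subscheme U of Spec A is affine: there is an isomorphism of ringed
   spaces (h, phi) from some Spec B onto U, i.e. a homeomorphism h of Spec B
   onto U together with isomorphisms phi_V : O(V) -> O(h^-1 V), V open in U,
   compatible with the restrictions.  An isomorphism of ringed spaces between
   locally ringed spaces is automatically local on the stalks. *)
Definition affine_open (A : comPzRingType) (U : set (spec A)) : Prop :=
  exists (B : comPzRingType) (h : spec B -> spec A)
         (phi : forall V : set (spec A), open V -> V `<=` U ->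
                  {rmorphism sections V -> sections (h @^-1` V)}),
  [/\ continuous h /\ (forall W, open W -> open (h @` W)),
      injective h /\ range h = U,
      forall V (oV : open V) (VU : V `<=` U), bijective (phi V oV VU) &
      forall V (oV : open V) (VU : V `<=` U) W (oW : open W) (WU : W `<=` U)
             (WV : W `<=` V) (s : sections V),
        phi W oW WU (sec_res WV s) =
        sec_res (preimage_subset (f := h) WV) (phi V oV VU s)].

(* The notions of this section are meant for a normal noetherian domain A, and
   divisors on A for those on Spec A.  Then the regular elements of A are the
   nonzero ones, a nonzero rational function is a fraction a / b of them, and
   the local ring of A at a prime of height one is a discrete valuation ring. *)

Section Divisors.
Variable A : comNzRingType.

Definition height_one (P : spec A) : Prop :=
  (exists Q : spec A, pset Q `<` pset P) /\
  ~ (exists Q1 Q2 : spec A, pset Q1 `<` pset Q2 /\ pset Q2 `<` pset P).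

Record prime_divisor := PrimeDivisor {
  pd_prime :> spec A;
  pd_height_one : height_one pd_prime
}.

HB.instance Definition _ := gen_eqMixin prime_divisor.
HB.instance Definition _ := gen_choiceMixin prime_divisor.

Definition Div := {freeg prime_divisor}.
HB.instance Definition _ := GRing.Zmodule.on Div.

Definition effective (D : Div) : Prop := forall P, 0 <= coeff P D :> int.

Definition supp_compl (D : Div) : set (spec A) :=
  [set Q | ~ exists2 P : prime_divisor, coeff P D != 0 & pset P `<=` pset Q].

Definition uniformizer (P : spec A) (t : stalk P) : Prop :=
  [set x | exists (a s : A) (hs : prime_compl P s), P a /\ x = frac a hs] =
  [set y * t | y in [set: stalk P]].

(* The valuation of a at P is n: a / 1 is a unit times t ^+ n, for one or
   equivalently (in a discrete valuation ring) for every uniformizer t. *)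
Definition ord_at (P : prime_divisor) (a : A) (n : nat) : Prop :=
  forall t : stalk P, uniformizer t ->
    exists2 u : stalk P, (exists v, v * u = 1) &
      to_loc (prime_compl P) a = u * t ^+ n.

Definition divisor_of (D : Div) (a b : A) : Prop :=
  forall P : prime_divisor, exists m n : nat,
    [/\ ord_at P a m, ord_at P b n & coeff P D = m%:Z - n%:Z].

Definition principal (D : Div) : Prop :=
  exists a b : A, [/\ GRing.lreg a, GRing.lreg b & divisor_of D a b].

Definition lin_equiv (D E : Div) : Prop := principal (D - E).

Definition coaffine (D : Div) : Prop :=
  forall E : Div, effective E -> lin_equiv E D -> affine_open (supp_compl E).

Definition strongly_coaffine (D : Div) : Prop :=
  forall n : int, coaffine (D *~ n) \/ principal (D *~ n).

Definition affine_trivial (D : Div) : Prop :=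
  forall E : Div, strongly_coaffine E -> strongly_coaffine (D + E).

Lemma ord_at1 P : ord_at P 1 0.
Proof. by move=> t _; exists 1; [exists 1; rewrite mulr1 | rewrite mulr1]. Qed.

Lemma ord_atM P a b m n :
  ord_at P a m -> ord_at P b n -> ord_at P (a * b) (m + n)%N.
Proof.
move=> ha hb t ut; have [u [u' u1] ea] := ha t ut; have [v [v' v1] eb] := hb t ut.
exists (u * v); first by exists (u' * v'); rewrite mulrACA u1 v1 mulr1.
have -> : to_loc (prime_compl P) (a * b) =
          to_loc (prime_compl P) a * to_loc (prime_compl P) b.
  by rewrite fracM; apply/frac_eqP; exists 1; [exact: mulset1 | rewrite mulr1].
by rewrite ea eb exprD mulrACA.
Qed.

Lemma principal0 : principal 0.
Proof.
exists 1, 1; split; [exact: lreg1 | exact: lreg1 | move=> P; exists 0%N, 0%N].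
by split; [exact: ord_at1 | exact: ord_at1 | rewrite coeff0].
Qed.

Lemma principalB D E : principal D -> principal E -> principal (D - E).
Proof.
move=> [a [b [la lb h]]] [c [d [lc ld k]]]; exists (a * d), (b * c).
split; [exact: lregM | exact: lregM | move=> P].
have [m [n [am bn e]]] := h P; have [p [q [cp dq f]]] := k P.
exists (m + q)%N, (n + p)%N; split; [exact: ord_atM | exact: ord_atM |].
rewrite coeffB e f !PoszD; ring.
Qed.

Lemma principalN D : principal D -> principal (- D).
Proof. by move=> h; rewrite -sub0r; apply: principalB => //; exact: principal0. Qed.

Lemma principalD D E : principal D -> principal E -> principal (D + E).
Proof. by move=> h k; rewrite -[E]opprK; apply: principalB => //; exact: principalN. Qed.

Lemma principalMz D n : principal D -> principal (D *~ n).
Proof.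
move=> h; have hn k : principal (D *+ k).
  by elim: k => [|k ih]; [exact: principal0 | rewrite mulrS; exact: principalD].
by case: n => k; [exact: hn | rewrite NegzE mulrNz; exact/principalN/hn].
Qed.

Lemma coaffine_equiv D E : principal (D - E) -> coaffine D -> coaffine E.
Proof.
move=> h cD F eF k; apply: cD => //; rewrite /lin_equiv.
have -> : F - D = (F - E) - (D - E) by rewrite opprB addrA subrK.
exact: principalB.
Qed.

Lemma strongly_coaffine_equiv D E :
  principal (D - E) -> strongly_coaffine D -> strongly_coaffine E.
Proof.
move=> h sD n; have hn := principalMz n h.
have en : (D - E) *~ n = D *~ n - E *~ n by rewrite mulrzBl.
case: (sD n) => [c|p]; [left | right].
  by apply: coaffine_equiv c; rewrite -en.
by rewrite -(subKr (D *~ n) (E *~ n)) -en; exact: principalB.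
Qed.

Lemma strongly_coaffineN D : strongly_coaffine D -> strongly_coaffine (- D).
Proof. by move=> sD n; have := sD (- n); rewrite mulrNz mulNrz. Qed.

Lemma strongly_coaffine0 : strongly_coaffine 0.
Proof. by move=> n; right; rewrite mul0rz; exact: principal0. Qed.

Lemma principal_affine_trivial D : principal D -> affine_trivial D.
Proof.
move=> h E; apply: strongly_coaffine_equiv.
by rewrite opprD addrCA subrr addr0; exact: principalN.
Qed.

Lemma affine_trivialN D : affine_trivial D -> affine_trivial (- D).
Proof.
move=> h E sE; rewrite -[E]opprK -opprD; apply: strongly_coaffineN.
by apply: h; exact: strongly_coaffineN.
Qed.

Lemma affine_trivialB D E :
  affine_trivial D -> affine_trivial E -> affine_trivial (D - E).
Proof.
by move=> h k F sF; rewrite -addrA; apply: h; apply: affine_trivialN.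
Qed.

Definition principal_pred : {pred Div} := fun D => `[< principal D >].
Definition affine_trivial_pred : {pred Div} := fun D => `[< affine_trivial D >].

Lemma principal_zmod_closed : zmod_closed principal_pred.
Proof.
split; first by apply/asboolP; exact: principal0.
by move=> D E /asboolP h /asboolP k; apply/asboolP; exact: principalB.
Qed.

Lemma affine_trivial_zmod_closed : zmod_closed affine_trivial_pred.
Proof.
split; first by apply/asboolP; apply: principal_affine_trivial; exact: principal0.
by move=> D E /asboolP h /asboolP k; apply/asboolP; exact: affine_trivialB.
Qed.

HB.instance Definition _ :=
  GRing.isZmodClosed.Build Div principal_pred principal_zmod_closed.
HB.instance Definition _ :=
  GRing.isZmodClosed.Build Div affine_trivial_pred affine_trivial_zmod_closed.

Definition Cl := Quotient.quot principal_pred.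
HB.instance Definition _ := GRing.Zmodule.on Cl.

Definition AffCl := Quotient.quot affine_trivial_pred.
HB.instance Definition _ := GRing.Zmodule.on AffCl.

Definition class_of (D : Div) : Cl := \pi_(Quotient.quot principal_pred) D.
Definition aclass_of (D : Div) : AffCl := \pi_(Quotient.quot affine_trivial_pred) D.

Definition Cl_to_AffCl (c : Cl) : AffCl := aclass_of (repr c).

Lemma Cl_to_AffClE D : Cl_to_AffCl (class_of D) = aclass_of D.
Proof.
have pr : principal (repr (class_of D) - D).
  apply/asboolP; rewrite -[X in is_true X]/(repr (class_of D) - D \in principal_pred).
  by rewrite Quotient.idealrBE reprK.
apply/eqP; rewrite -Quotient.idealrBE; apply/asboolP.
exact: principal_affine_trivial.
Qed.

Lemma Cl_to_AffCl_is_zmod_morphism : zmod_morphism Cl_to_AffCl.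
Proof.
have cl z : exists D, z = class_of D by exists (repr z); rewrite /class_of reprK.
move=> x y; have [D ->] := cl x; have [E ->] := cl y.
have -> : class_of D - class_of E = class_of (D - E) by rewrite /class_of raddfB.
by rewrite !Cl_to_AffClE /aclass_of raddfB.
Qed.

HB.instance Definition _ :=
  GRing.isZmodMorphism.Build Cl AffCl Cl_to_AffCl Cl_to_AffCl_is_zmod_morphism.

End Divisors.

Section XYRing.
Variables (R : idomainType) (f : R).

(* R[X][Y], with X = 'X%:P and Y = 'X. *)
Definition xy_poly : {poly {poly R}} := 'X%:P * 'X - f%:P%:P.

Definition xy_ideal : {pred {poly {poly R}}} :=
  fun p => `[< exists q, p = q * xy_poly >].

Lemma xy_ideal_closed : idealr_closed xy_ideal.
Proof.
split.
- by apply/asboolP; exists 0; rewrite mul0r.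
- have sz : size xy_poly = 2.
    rewrite /xy_poly mul_polyC -polyCN size_polyDl size_scale ?polyX_eq0 ?size_polyX //.
    by rewrite (leq_ltn_trans (size_polyC_leq1 _)).
  apply/asboolP => -[q e]; have q0 : q != 0.
    by apply: contra_eq_neq e => ->; rewrite mul0r oner_eq0.
  have g0 : xy_poly != 0 by rewrite -size_poly_eq0 sz.
  have := congr1 (fun p : {poly {poly R}} => size p) e.
  rewrite size_poly1 size_mul // sz addn2 /=.
  by case=> /esym/eqP; rewrite size_poly_eq0 (negbTE q0).
- move=> a _ _ /asboolP[p ->] /asboolP[q ->]; apply/asboolP.
  by exists (a * p + q); rewrite mulrDl mulrA.
Qed.

HB.instance Definition _ := isIdealr.Build {poly {poly R}} xy_ideal xy_ideal_closed.

Definition xy_ring := Quotient.quot xy_ideal.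
HB.instance Definition _ := GRing.ComNzRing.on xy_ring.

End XYRing.

(* Main.v *)
(** Write A for R[X,Y]/(XY - f), with x and y the classes of X and Y. Every
    element of A is uniquely p(x) + y q(y), and A[1/x] = R[x,1/x] and
    A[1/y] = R[y,1/y] are localizations of polynomial rings, which are factorial
    by Gauss. No prime of height one contains both x and y, so each of them is
    cut out by a prime polynomial in one of these two charts; in particular its
    local ring is a discrete valuation ring, and divisibility in A can be tested
    at the primes of height one.

    If nD is principal with n > 0 and E is effective and equivalent to kD, then
    nE is the divisor of some c in A and the complement of E is D(c), which is
    affine. Conversely, every divisor is equivalent to a combination of the
    components P_i = (x, U_i) of div x = sum_i d_i P_i. Subtracting a multiple
    of div x from a multiple of D one reaches an effective E = sum_i e_i P_i with
    some e_i = 0. If E is not 0, its complement is D(x) U D(w), where w is the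
    product of the U_j with e_j <> 0; were it affine, x and w would generate the
    unit ideal in its ring of functions R[x, v/x], where U_i divides v, and then
    1 would lie in the ideal (U_i, w) of the local ring R. *)

From HB Require Import structures.
From mathcomp Require Import all_boot all_order all_algebra.
From mathcomp Require Import generic_quotient ring_quotient.
From mathcomp Require Import all_classical topology freeg.
From mathcomp Require Import zify ring.

Require Import Defs.
Set Implicit Arguments.
Unset Strict Implicit.
Unset Printing Implicit Defensive.

Import Order.TTheory GRing.Theory Num.Theory.
Local Open Scope classical_set_scope.
Local Open Scope quotient_scope.
Local Open Scope ring_scope.

(** * Prime ideals *)

Section Ideals.
Variable A : comPzRingType.
Implicit Types (I J : set A) (P Q : spec A).

Lemma prime0 P : P 0.
Proof. by case: (pset_ideal P). Qed.

Lemma primeD P a b : P a -> P b -> P (a + b).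
Proof. by case: (pset_ideal P) => _ PD _; exact: PD. Qed.

Lemma primeMl P a b : P b -> P (a * b).
Proof. by case: (pset_ideal P) => _ _; exact. Qed.

Lemma primeMr P a b : P a -> P (a * b).
Proof. by rewrite mulrC; exact: primeMl. Qed.

Lemma primeX P a n : P (a ^+ n) -> P a.
Proof.
by elim: n => [/pset_proper //|n IH]; rewrite exprS => /pset_prime [].
Qed.

Lemma notin_primeM P a b : ~ P a -> ~ P b -> ~ P (a * b).
Proof. by move=> na nb /pset_prime []. Qed.

Lemma notin_primeX P a n : ~ P a -> ~ P (a ^+ n).
Proof. by move=> na /primeX. Qed.

Lemma spec_ext P Q : (forall a, P a <-> Q a) -> P = Q.
Proof.
case: P Q => [P Pi Pp Pm] [Q Qi Qp Qm] /= PQ.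
have ePQ : P = Q by apply/funext => a; apply/propext.
by case: _ / ePQ Qi Qp Qm {PQ} => *; congr Spec; exact: Prop_irrelevance.
Qed.

Definition adjoin I a : set A := [set z | exists2 m, I m & exists c, z = m + c * a].

Lemma adjoin_ideal I a : is_ideal I -> is_ideal (adjoin I a).
Proof.
move=> [I0 ID IM]; split.
- by exists 0 => //; exists 0; rewrite mul0r addr0.
- move=> _ _ [m Im [c ->]] [n In [e ->]]; exists (m + n); first exact: ID.
  by exists (c + e); ring.
- move=> b _ [m Im [c ->]]; exists (b * m); first exact: IM.
  by exists (b * c); ring.
Qed.

Lemma sub_adjoin I a : I `<=` adjoin I a.
Proof. by move=> m Im; exists m => //; exists 0; rewrite mul0r addr0. Qed.

Lemma mem_adjoin I a : is_ideal I -> adjoin I a a.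
Proof. by move=> [I0 _ _]; exists 0 => //; exists 1; rewrite mul1r add0r. Qed.

Lemma ideal_gen_ideal (a : A) : is_ideal [set c * a | c in setT].
Proof.
split; first by exists 0; rewrite ?mul0r.
- by move=> _ _ [b _ <-] [c _ <-]; exists (b + c); rewrite ?mulrDl.
- by move=> b _ [c _ <-]; exists (b * c); rewrite ?mulrA.
Qed.

Lemma exists_maximal_avoiding I (S : set A) :
    is_ideal I -> (forall a, I a -> ~ S a) ->
  exists M : set A, [/\ is_ideal M, I `<=` M, forall a, M a -> ~ S a &
    forall J, is_ideal J -> M `<=` J -> (forall a, J a -> ~ S a) -> J = M].
Proof.
move=> II IS.
(* Zorn is applied to the sets [X] whose union with [I] is an ideal avoiding [S]; in this form the
   empty chain, whose union is empty, is no special case. *)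
pose P X := is_ideal (I `|` X) /\ (forall a, (I `|` X) a -> ~ S a).
have chain (F : set (set A)) : F `<=` P -> total_on F subset ->
    P (\bigcup_(X in F) X).
  move=> FP tF.
  have inU X : F X -> I `|` X `<=` I `|` \bigcup_(X in F) X.
    by move=> FX; apply: setUS => a Xa; exists X.
  have [I0 ID IM] := II; split; first (split; first by left).
  - have key X a b : F X -> X a -> (I `|` X) b ->
        (I `|` \bigcup_(X in F) X) (a + b).
      move=> FX Xa Xb; apply: (inU X FX); have [[_ XD _] _] := FP X FX.
      by apply: XD => //; right.
    move=> a b [Ia|[X FX Xa]] [Ib|[Y FY Yb]].
    + by left; exact: ID.
    + by rewrite addrC; apply: (key Y) => //; left.
    + by apply: (key X) => //; left.
    + have [XY|YX] := tF X Y FX FY.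
        by apply: (key Y) => //; [exact: XY | right].
      by apply: (key X) => //; right; exact: YX.
  - move=> a b [Ib|[X FX Xb]]; first by left; exact: IM.
    by apply: (inU X FX); have [[_ _ XM] _] := FP X FX; apply: XM; right.
  - by move=> a [Ia|[X FX Xa]]; [exact: IS | apply: (FP X FX).2; right].
have [X [[XI XS] Xmax]] := Zorn_bigcup chain.
exists (I `|` X); split=> // J JI XJ JS.
have IJ : I `|` J = J by apply/setUidPr => a Ia; apply: XJ; left.
have PJ : P J by rewrite /P IJ.
apply: contrapT => nJ; apply: (Xmax J) => //; split.
  by move=> a Xa; apply: XJ; right.
by move=> JX; apply: nJ; apply/seteqP; split=> // a /JX; right.
Qed.

Lemma exists_prime_avoiding I (S : mulset A) :
    is_ideal I -> (forall a, I a -> ~ S a) ->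
  exists2 P : spec A, I `<=` pset P & forall a, P a -> ~ S a.
Proof.
move=> II IS; have [M [MI IM MS Mmax]] := exists_maximal_avoiding II IS.
have meetS a : ~ M a -> exists2 m, M m & exists c, S (m + c * a).
  move=> nMa; apply: contrapT => h; apply: nMa.
  rewrite -(Mmax (adjoin M a)); [exact: mem_adjoin | exact: adjoin_ideal |
    exact: sub_adjoin |].
  by move=> _ [m Mm [c ->]] Sa; apply: h; exists m => //; exists c.
have M1 : ~ M 1 by move=> /MS; apply; exact: mulset1.
have Mp a b : M (a * b) -> M a \/ M b.
  move=> Mab; apply: contrapT => /not_orP[/meetS[m Mm [c Sa]] /meetS[n Mn [e Sb]]].
  (* The product of the elements of [S] found in the ideals [(M, a)] and [(M, b)] falls into [M]
     because [a * b] does. *)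
  apply: MS (mulsetM Sa Sb); have [_ MD MM] := MI.
  have -> : (m + c * a) * (n + e * b) =
    (n + e * b) * m + ((c * a) * n + (c * e) * (a * b)) by ring.
  by apply: (MD _ _ (MM _ _ Mm)); apply: MD; exact: MM.
by exists (Spec MI M1 Mp).
Qed.

Lemma powers_subproof1 (g : A) : exists n, 1 = g ^+ n.
Proof. by exists 0%N. Qed.

Lemma powers_subproofM (g s t : A) :
  (exists n, s = g ^+ n) -> (exists n, t = g ^+ n) -> exists n, s * t = g ^+ n.
Proof. by move=> [m ->] [n ->]; exists (m + n)%N; rewrite exprD. Qed.

Definition powers (g : A) : mulset A :=
  MulSet (powers_subproof1 g) (@powers_subproofM g).

Lemma mem_powers (g : A) n : powers g (g ^+ n).
Proof. by exists n. Qed.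

(** The radical of [I] is the intersection of the primes above [I]: if no power of [g] is in [I],
    some prime above [I] avoids them all. *)
Lemma prime_avoiding_power I g :
    is_ideal I -> (forall P, I `<=` pset P -> P g) -> exists n, I (g ^+ n).
Proof.
move=> II IPg; apply: contrapT => nI.
have [|P IP Pg] := @exists_prime_avoiding I (powers g) II.
  by move=> a Ia [n an]; apply: nI; exists n; rewrite -an.
by apply: (Pg g (IPg P IP)); exists 1%N.
Qed.

(** Quasi-compactness of D(g). The elements lying in every prime that contains some finite part of
    [C] form an ideal; a prime above it contains all of [C], hence [g], so a power of [g] is in
    it. *)
Lemma quasi_compact_basic (g : A) (C : A -> Prop) :
    (forall P, ~ P g -> exists2 h, C h & ~ P h) ->
  exists2 l : seq A, (forall h, h \in l -> C h) &
    forall P, ~ P g -> exists2 h, h \in l & ~ P h.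
Proof.
move=> cov; pose I : set A := [set z | exists2 l : seq A, (forall h, h \in l -> C h) &
  forall P, (forall h, h \in l -> P h) -> P z].
have II : is_ideal I.
  split.
  - by exists [::] => // P _; exact: prime0.
  - move=> a b [l lC lP] [k kC kP]; exists (l ++ k).
      by move=> h; rewrite mem_cat => /orP[/lC|/kC].
    move=> P Ph; apply: primeD; [apply: lP | apply: kP] => h hl;
      by apply: Ph; rewrite mem_cat hl ?orbT.
  - by move=> a b [l lC lP]; exists l => // P /lP; exact: primeMl.
have [P IP|n [l lC lP]] := @prime_avoiding_power I g II.
  apply: contrapT => /cov[h Ch]; apply; apply: IP.
  exists [:: h] => [k|Q Qh]; first by rewrite inE => /eqP->.
  by apply: Qh; rewrite inE.
exists l => // P Pg; apply: contrapT => h; apply: Pg.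
apply: (@primeX P g n); apply: lP => k kl; apply: contrapT => Pk.
by apply: h; exists k.
Qed.

(** An ideal containing [a] and maximal among those avoiding 1 is a maximal ideal, hence the only
    one. *)
Lemma local_mem_maximal (a : A) :
    local_ring A -> (forall b : A, b * a <> 1) ->
  forall M : set A, is_maximal_ideal M -> M a.
Proof.
move=> [M0 [_ uM]] na M /uM <-.
have [c [d _ <-] /= ed|N [NI IN N1 Nmax]] :=
  @exists_maximal_avoiding _ [set 1] (ideal_gen_ideal a).
  exact: na ed.
have -> : M0 = N; last by apply: IN; exists 1; rewrite ?mul1r.
apply: uM; split=> // [/N1 //|J JI J1 NJ]; first exact.
by apply: Nmax => // b Jb /= b1; apply: J1; rewrite -b1.
Qed.

Lemma local_nonunit_comb (a b c e : A) :
    local_ring A -> (forall z : A, z * a <> 1) -> (forall z : A, z * b <> 1) ->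
  c * a + e * b <> 1.
Proof.
move=> lA na nb h; have [M [mM _]] := lA; have [[_ MD MM] M1 _] := mM.
by apply: M1; rewrite -h; apply: MD; apply: MM; exact: local_mem_maximal lA _ M mM.
Qed.

End Ideals.

(** * Sections over basic open sets *)

Section Localization.
Variables (A : comPzRingType) (S : mulset A).
Local Notation "a %:L" := (to_loc S a) (at level 2, format "a %:L").

Lemma to_loc_is_zmod_morphism : zmod_morphism (to_loc S).
Proof.
move=> a b; rewrite /to_loc fracN fracD; apply/frac_eqP.
by exists 1; [exact: mulset1 | ring].
Qed.

Lemma to_loc_is_monoid_morphism : monoid_morphism (to_loc S).
Proof.
split=> // a b; rewrite /to_loc fracM; apply/frac_eqP.
by exists 1; [exact: mulset1 | ring].
Qed.

HB.instance Definition _ :=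
  GRing.isZmodMorphism.Build A (loc S) (to_loc S) to_loc_is_zmod_morphism.
HB.instance Definition _ :=
  GRing.isMonoidMorphism.Build A (loc S) (to_loc S) to_loc_is_monoid_morphism.

Lemma to_loc_eqP a b : a%:L = b%:L <-> exists2 w, S w & w * a = w * b.
Proof.
rewrite /to_loc; split=> [/frac_eqP [w Sw]|[w Sw e]].
  by rewrite !mulr1 => e; exists w.
by apply/frac_eqP; exists w; rewrite ?mulr1.
Qed.

Lemma fracMden a s (hs : S s) : s%:L * frac a hs = a%:L.
Proof.
by rewrite fracM; apply/frac_eqP; exists 1; [exact: mulset1 | ring].
Qed.

Lemma denMinv s (hs : S s) : s%:L * frac 1 hs = 1.
Proof. by rewrite fracMden rmorph1. Qed.

Lemma to_loc_lreg s : S s -> GRing.lreg s%:L.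
Proof.
move=> Ss x y /(congr1 (fun z => frac 1 Ss * z)).
by rewrite !mulrA !(mulrC (frac 1 Ss)) denMinv !mul1r.
Qed.

(** [S] need not be saturated, so the criterion asks for a multiple of [a] in [S] and not for [a]
    itself. *)
Lemma loc_unitP a : (exists v, v * a%:L = 1) <-> exists b, S (b * a).
Proof.
split=> [[v]|[b Sba]]; last first.
  exists (b%:L * frac 1 Sba).
  by rewrite mulrAC -rmorphM denMinv.
have [b [s [hs ->]]] := fracP v => /(congr1 (fun z => s%:L * z)).
rewrite mulrA fracMden mulr1 -rmorphM => /to_loc_eqP[w Sw e].
by exists (w * b); rewrite -mulrA e; exact: mulsetM.
Qed.

End Localization.

Section Sections.
Variable A : comPzRingType.
Implicit Types (P Q : spec A) (U V : set (spec A)).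
Local Notation "a %:L_ P" := (to_loc (prime_compl P) a) (at level 2, P at level 2,
  format "a %:L_ P").

Lemma open_basicP V P : open V -> V P ->
  exists2 e : A, ~ P e & forall Q, ~ Q e -> V Q.
Proof.
move=> [T ->] /= nTP.
have [e [Te nPe]] : exists e, T e /\ ~ P e.
  apply: contrapT => h; apply: nTP => e Te.
  by apply: contrapT => nPe; apply: h; exists e.
by exists e => // Q nQe /(_ e Te).
Qed.

Lemma open_basic (g : A) : open [set P : spec A | ~ P g].
Proof.
exists [set g]; apply/seteqP; split=> P /= h; first by move=> /(_ g erefl).
by move=> Pg; apply: h => _ ->.
Qed.

(** The annihilator of [z] lies in no prime avoiding [g], so it contains a power of [g]. *)
Lemma ann_power (g z : A) : (forall P, ~ P g -> z%:L_P = 0) ->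
  exists n, g ^+ n * z = 0.
Proof.
move=> z0; pose I : set A := [set w | w * z = 0].
have II : is_ideal I.
  by split=> [|a b /= az bz|a b /= bz];
    rewrite /I /= ?mul0r ?mulrDl ?az ?bz ?addr0 // -mulrA bz mulr0.
have [P IP|n In] := @prime_avoiding_power _ I g II; last by exists n.
apply: contrapT => /z0; rewrite -(rmorph0 (to_loc _)).
by move=> /to_loc_eqP[w nPw]; rewrite mulr0 => /IP.
Qed.

Section Fraction.
Variables (V : set (spec A)) (s : sections V).

(** The section is a / h on D(h), with the denominator cleared; the existential over [VQ] also
    records that D(h) lies in [V]. *)
Definition fraction_on (h a : A) :=
  forall Q, ~ Q h -> exists VQ : V Q, h%:L_Q * s Q VQ = a%:L_Q.

Lemma fraction_onP h a Q (VQ : V Q) :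
  fraction_on h a -> ~ Q h -> h%:L_Q * s Q VQ = a%:L_Q.
Proof. by move=> ha /ha[VQ']; rewrite (Prop_irrelevance VQ VQ'). Qed.

Lemma sections_fraction_near P : V P -> (exists2 e, ~ P e & forall Q, ~ Q e -> V Q) ->
  exists2 h, exists a, fraction_on h a & ~ P h.
Proof.
move=> VP [e0 Pe0 e0V]; have [W [a [k [oW WP hs]]]] := sec_locally s VP.
have [e Pe eW] := open_basicP oW WP.
exists (e0 * (e * k)).
  exists ((e0 * e) * a) => Q Qe.
  have Qe0 : ~ Q e0 by move=> h; apply: Qe; exact: primeMr.
  have Qe' : ~ Q e by move=> h; apply: Qe; apply: primeMl; exact: primeMr.
  exists (e0V Q Qe0); have [kQ ->] := hs Q (e0V Q Qe0) (eW Q Qe').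
  by rewrite mulrA rmorphM /= -mulrA (fracMden a kQ) -rmorphM.
have [kP _] := hs P VP WP.
by apply: notin_primeM => //; exact: notin_primeM.
Qed.

(** The two fractions agree on D(h h'), so a power of [h * h'] kills the difference of the cross
    products. At a prime avoiding [h'] the power of [h'] is cancelled, and a power of [h] remains,
    the same for all [Q], including those that contain [h]. *)
Lemma fraction_on_overlap h a h' a' : fraction_on h a -> fraction_on h' a' ->
  exists n, forall Q (VQ : V Q), ~ Q h' ->
    (h ^+ n)%:L_Q * (h%:L_Q * s Q VQ - a%:L_Q) = 0.
Proof.
move=> ha ha'; have [n hn] : exists n, (h * h') ^+ n * (h * a' - h' * a) = 0.
  apply: ann_power => Q Qhh'.
  have Qh : ~ Q h by move=> k; apply: Qhh'; exact: primeMr.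
  have Qh' : ~ Q h' by move=> k; apply: Qhh'; exact: primeMl.
  have [VQ e] := ha Q Qh; have e' := fraction_onP VQ ha' Qh'.
  by rewrite rmorphB !rmorphM /= -e -e'; ring.
exists n => Q VQ Qh'; apply: (@to_loc_lreg _ (prime_compl Q) (h' ^+ n.+1)).
  exact: notin_primeX.
rewrite mulr0 exprS -(rmorph0 (to_loc _)) -hn exprMn rmorphM /=.
by rewrite !(rmorphM, rmorphB) /= -(fraction_onP VQ ha' Qh'); ring.
Qed.

(** Sections over D(g) have a power of [g] as denominator. The ideal [K] of global denominators
    contains a power of each local denominator [h]: by quasi-compactness finitely many overlaps
    suffice, and they share one exponent. So each prime above [K] contains [g]. *)
Lemma sections_fraction g : (forall P, ~ P g -> V P) ->
  exists a n, fraction_on (g ^+ n.+1) a.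
Proof.
move=> gV; pose K : set A := [set k | exists a, forall Q (VQ : V Q), ~ Q g ->
  k%:L_Q * s Q VQ = a%:L_Q].
have KI : is_ideal K.
  split.
  - by exists 0 => Q VQ _; rewrite rmorph0 mul0r.
  - move=> k l [a ka] [b lb]; exists (a + b) => Q VQ Qg.
    by rewrite !rmorphD mulrDl ka // lb.
  - move=> c k [a ka]; exists (c * a) => Q VQ Qg.
    by rewrite !rmorphM -mulrA ka.
have near P : ~ P g -> exists2 h, exists a, fraction_on h a & ~ P h.
  by move=> Pg; apply: sections_fraction_near; [exact: gV | exists g].
have [P KP|n [a an]] := @prime_avoiding_power _ K g KI; last first.
  (* The additional factor [g] makes the exponent positive; with exponent 0 the claim would range
     over all primes and not only over those avoiding [g]. *)
  exists (g * a), n => Q Qgn.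
  have Qg : ~ Q g by move=> Qg; apply: Qgn; rewrite exprS; exact: primeMr.
  by exists (gV Q Qg); rewrite exprS !rmorphM -mulrA an.
apply: contrapT => Pg; have [h [a ha] Ph] := near P Pg.
have [l lF lcov] := quasi_compact_basic near.
have [n hn] : exists n, forall h', h' \in l -> forall Q (VQ : V Q), ~ Q h' ->
    (h ^+ n)%:L_Q * (h%:L_Q * s Q VQ - a%:L_Q) = 0.
  elim: l lF {lcov} => [|h' l IH] lF; first by exists 0%N.
  have [|n hn] := IH; first by move=> k kl; apply: lF; rewrite inE kl orbT.
  have [a' ha'] := lF h' (mem_head _ _).
  have [m hm] := fraction_on_overlap ha ha'.
  exists (m + n)%N => k; rewrite inE => /orP[/eqP->|kl] Q VQ Qk.
    by rewrite addnC exprD rmorphM /= -mulrA hm // mulr0.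
  by rewrite exprD rmorphM /= -mulrA (hn k kl) // mulr0.
apply: Ph; apply: (@primeX _ P h n.+1); apply: KP.
exists (h ^+ n * a) => Q VQ Qg; have [h' h'l Qh'] := lcov Q Qg.
apply/eqP; rewrite -subr_eq0 -(hn h' h'l Q VQ Qh') exprS !rmorphM /=.
by apply/eqP; ring.
Qed.

End Fraction.

End Sections.

(** * Affine open sets *)

Section SectionConstants.
Variable A : comPzRingType.
Implicit Type V : set (spec A).

Lemma sec_cst_is_zmod_morphism V : zmod_morphism (sec_cst V).
Proof. by move=> a b; apply: sec_ext => P VP; exact: rmorphB. Qed.

Lemma sec_cst_is_monoid_morphism V : monoid_morphism (sec_cst V).
Proof.
by split=> [|a b]; apply: sec_ext => P VP; [exact: rmorph1 | exact: rmorphM].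
Qed.

HB.instance Definition _ V :=
  GRing.isZmodMorphism.Build A (sections V) (sec_cst V) (sec_cst_is_zmod_morphism V).
HB.instance Definition _ V :=
  GRing.isMonoidMorphism.Build A (sections V) (sec_cst V)
    (sec_cst_is_monoid_morphism V).

Lemma global_section V (s : sections V) :
  (forall P, V P) -> exists b, s = sec_cst V b.
Proof.
move=> VT; have [b [n bn]] := @sections_fraction _ V s 1 (fun P _ => VT P).
exists b; apply: sec_ext => P VP; rewrite expr1n in bn.
rewrite -[LHS]mul1r -(rmorph1 (to_loc (prime_compl P))).
by rewrite (fraction_onP VP bn) //; exact: pset_proper.
Qed.

Lemma sec_cst_inv V x : (forall P, V P -> ~ P x) -> exists z, z * sec_cst V x = 1.
Proof.
move=> Vx; pose z P (VP : V P) : stalk P := @frac _ (prime_compl P) 1 x (Vx P VP).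
have lz : locally_fraction z.
  move=> P VP; exists setT, 1, x; split=> //; first exact: openT.
  by move=> Q VQ _; exists (Vx Q VQ).
exists (Sections lz); apply: sec_ext => P VP.
by rewrite mulrC; exact: denMinv.
Qed.

End SectionConstants.

(** On Spec B the functions corresponding to [x] and [w] are global, hence elements [b] and [c] of
    [B]. No prime of [B] contains both, so they generate the unit ideal, and the relation is carried
    back along [phi]. *)
Lemma affine_cover_unit (A : comPzRingType) (W : set (spec A)) (x w : A) :
    affine_open W -> (forall P, W P -> ~ P x \/ ~ P w) ->
  exists a b : sections W, a * sec_cst W x + b * sec_cst W w = 1.
Proof.
move=> [B [h [phi [[_ hO] [_ hW] phiB phiR]]]] cov.
have oW : open W by rewrite -hW; apply: hO; exact: openT.
pose phiW := phi W oW (fun P WP => WP).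
have VT Q : (h @^-1` W) Q by rewrite /= -hW; exists Q.
(* No maps of stalks come with [phi]. That [b] is a unit at [M] is seen by inverting [y] as a
   section over the part of [W] where it does not vanish, and by transporting this inverse. *)
have nonvan y b : phiW (sec_cst W y) = sec_cst _ b ->
    forall M : spec B, ~ h M y -> ~ M b.
  move=> yb M hMy.
  pose V : set (spec A) := W `&` [set P | ~ P y].
  have oV : open V by apply: openI => //; exact: open_basic.
  have VW : V `<=` W by move=> P [].
  have [z zy] := @sec_cst_inv _ V y (fun P VP => VP.2).
  have /(congr1 (phi _ oV VW)) := zy; rewrite rmorphM rmorph1.
  have -> : sec_cst V y = sec_res VW (sec_cst W y).
    by apply: sec_ext.
  rewrite (phiR W oW (fun P WP => WP)) -/phiW yb => e.
  have VM : (h @^-1` V) M by split=> //; exact: VT.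
  have /(congr1 (fun s : sections _ => s M VM)) /= e' := e.
  have [c Mcb] : exists c, prime_compl M (c * b).
    by apply/loc_unitP; exists (phi _ oV VW z M VM).
  by move=> Mb; apply: Mcb; exact: primeMl.
have [b xb] := global_section (phiW (sec_cst W x)) VT.
have [c wc] := global_section (phiW (sec_cst W w)) VT.
have [M IM|n] := @prime_avoiding_power _ (adjoin [set a * b | a in setT] c) 1
    (adjoin_ideal c (ideal_gen_ideal b)).
  have Mb : M b by apply: IM; apply: sub_adjoin; exists 1; rewrite ?mul1r.
  have Mc : M c by apply: IM; apply: mem_adjoin; exact: ideal_gen_ideal.
  by have [/(nonvan _ _ xb)|/(nonvan _ _ wc)] := cov _ (VT M).
rewrite expr1n => -[_ [e _ <-] [d ed]].
have [psi phiK psiK] := phiB W oW (fun P WP => WP).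
exists (psi (sec_cst _ e)), (psi (sec_cst _ d)).
apply: (can_inj phiK); rewrite rmorphD !rmorphM rmorph1 !psiK -/phiW xb wc.
by rewrite -!rmorphM -rmorphD -ed rmorph1.
Qed.

(** * Basic open sets as spectra of localizations *)

Section StalkMap.
Variables (A B : comPzRingType) (phi : {rmorphism A -> B}).
Variables (P : spec A) (Q : spec B) (PQ : forall a, P a <-> Q (phi a)).

Lemma stalk_map_subproof s : prime_compl P s -> prime_compl Q (phi s).
Proof. by move=> Ps /PQ. Qed.

(** [P] is tied to [Q] by the equivalence [PQ] and not by an equality, so that one map serves both
    for [contract Q] with [Q] and for [P] with its extension. *)
Definition stalk_map (z : stalk P) : stalk Q :=
  let: PreLoc a s hs := repr (z : loc (prime_compl P)) in
  frac (phi a) (stalk_map_subproof hs).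

Lemma stalk_mapE a s (hs : prime_compl P s) :
  stalk_map (frac a hs) = frac (phi a) (stalk_map_subproof hs).
Proof.
rewrite /stalk_map; have [b [t [ht [-> [w Pw e]]]]] := repr_frac a hs.
apply/frac_eqP; exists (phi w); first exact: stalk_map_subproof.
by rewrite -!rmorphM e.
Qed.

Lemma stalk_map_is_zmod_morphism : zmod_morphism stalk_map.
Proof.
move=> x y; have [a [s [hs ->]]] := fracP x; have [b [t [ht ->]]] := fracP y.
rewrite fracN fracD !stalk_mapE fracN fracD; apply/frac_eqP.
exists 1; first exact: mulset1.
by rewrite rmorphD !rmorphM rmorphN; ring.
Qed.

Lemma stalk_map_is_monoid_morphism : monoid_morphism stalk_map.
Proof.
split; first by rewrite -(frac1 (mulset1 (prime_compl P))) stalk_mapE; exact: frac1.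
move=> x y; have [a [s [hs ->]]] := fracP x; have [b [t [ht ->]]] := fracP y.
rewrite fracM !stalk_mapE fracM; apply/frac_eqP.
exists 1; first exact: mulset1.
by rewrite !rmorphM.
Qed.

HB.instance Definition _ :=
  GRing.isZmodMorphism.Build (stalk P) (stalk Q) stalk_map stalk_map_is_zmod_morphism.
HB.instance Definition _ :=
  GRing.isMonoidMorphism.Build (stalk P) (stalk Q) stalk_map
    stalk_map_is_monoid_morphism.

End StalkMap.

(* The three hypotheses on [phi : A -> B] characterize the localization of [A]
   at the powers of [g]. *)
Section BasicOpenAffine.
Variables (A B : comPzRingType) (phi : {rmorphism A -> B}) (g : A).
Hypothesis phi_unit : exists v, v * phi g = 1.
Hypothesis phi_surj : forall b, exists a n, phi (g ^+ n) * b = phi a.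
Hypothesis phi_inj : forall a a', phi a = phi a' ->
  exists n, g ^+ n * a = g ^+ n * a'.

Let notin_g (Q : spec B) n : ~ Q (phi (g ^+ n)).
Proof.
rewrite rmorphXn; apply: notin_primeX => Qg; have [v v1] := phi_unit.
by apply: (@pset_proper _ Q); rewrite -v1; exact: primeMl.
Qed.

Lemma contract_ideal (Q : spec B) : is_ideal [set a | Q (phi a)].
Proof.
split=> /=; first by rewrite rmorph0; exact: prime0.
- by move=> a b Qa Qb; rewrite rmorphD; exact: primeD.
- by move=> a b Qb; rewrite rmorphM; exact: primeMl.
Qed.

Lemma contract_proper (Q : spec B) : ~ Q (phi 1).
Proof. by rewrite rmorph1; exact: pset_proper. Qed.

Lemma contract_prime (Q : spec B) a b :
  Q (phi (a * b)) -> Q (phi a) \/ Q (phi b).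
Proof. by rewrite rmorphM; exact: pset_prime. Qed.

Definition contract (Q : spec B) : spec A :=
  Spec (contract_ideal Q) (@contract_proper Q) (@contract_prime Q).

Lemma mem_contract Q a : contract Q a <-> Q (phi a).
Proof. by []. Qed.

Lemma contract_inj : injective contract.
Proof.
move=> Q Q' QQ'; apply: spec_ext => b; have [a [n ab]] := phi_surj b.
have key (Q0 : spec B) : Q0 b <-> contract Q0 a.
  rewrite mem_contract -ab; split=> [|/pset_prime[/notin_g //|//]].
  exact: primeMl.
by rewrite (key Q) (key Q') QQ'.
Qed.

Section Extension.
Variables (P : spec A) (Pg : ~ P g).

Definition extend_set : set B :=
  [set b | exists a n, phi (g ^+ n) * b = phi a /\ P a].

(** Membership may be read off any fraction representing [b]: two of them agree up to powers of [g],
    which [P] avoids. *)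
Lemma mem_extend a n b : phi (g ^+ n) * b = phi a -> extend_set b <-> P a.
Proof.
move=> ab; split=> [[a' [m [ab' Pa']]]|Pa]; last by exists a, n.
have [k ek] : exists k, g ^+ k * (g ^+ m * a) = g ^+ k * (g ^+ n * a').
  by apply: phi_inj; rewrite !rmorphM -ab -ab'; ring.
have : P (g ^+ k * (g ^+ m * a)) by rewrite ek mulrA; exact: primeMl.
by case/pset_prime=> [/primeX //|/pset_prime[/primeX|]].
Qed.

Lemma extend_ideal : is_ideal extend_set.
Proof.
split.
- by exists 0, 0%N; split; [rewrite mulr0 rmorph0 | exact: prime0].
- move=> b b' [a [n [ab Pa]]] [a' [n' [ab' Pa']]].
  exists (g ^+ n' * a + g ^+ n * a'), (n + n')%N; split.
    by rewrite exprD rmorphD !rmorphM -ab -ab'; ring.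
  by apply: primeD; exact: primeMl.
- move=> c b [a [n [ab Pa]]]; have [e [m ec]] := phi_surj c.
  exists (e * a), (m + n)%N; split; last exact: primeMl.
  by rewrite exprD !rmorphM -ab -ec; ring.
Qed.

Lemma extend_proper : ~ extend_set 1.
Proof.
rewrite (@mem_extend 1 0%N); first exact: pset_proper.
by rewrite mulr1.
Qed.

Lemma extend_prime b c : extend_set (b * c) -> extend_set b \/ extend_set c.
Proof.
have [a [n ab]] := phi_surj b; have [e [m ec]] := phi_surj c.
rewrite (mem_extend ab) (mem_extend ec) (@mem_extend (a * e) (n + m)%N).
  exact: pset_prime.
by rewrite exprD !rmorphM -ab -ec; ring.
Qed.

Definition extend : spec B := Spec extend_ideal extend_proper extend_prime.

Lemma extendP a : P a <-> extend (phi a).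
Proof. by symmetry; apply: (@mem_extend _ 0%N); rewrite rmorph1 mul1r. Qed.

Lemma contract_extend : contract extend = P.
Proof. by apply: spec_ext => a; rewrite extendP. Qed.

End Extension.

Lemma range_contract : range contract = [set P | ~ P g].
Proof.
apply/seteqP; split=> [_ [Q _ <-] /=|P /= Pg]; first exact: (@notin_g Q 1).
by exists (extend Pg) => //; exact: contract_extend.
Qed.

Lemma contract_continuous : continuous contract.
Proof.
apply/continuousP => _ [T ->]; exists (phi @` T).
apply/seteqP; split=> Q /= nT sT; apply: nT.
  by move=> a Ta; apply: sT; exists a.
by move=> _ [a Ta <-]; exact: (sT a).
Qed.

Lemma contract_open_map (W : set (spec B)) : open W -> open (contract @` W).
Proof.
move=> [T ->]; exists [set g * a | a in [set a | exists2 b, T b &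
  exists n, phi (g ^+ n) * b = phi a]].
apply/seteqP; split=> [_ [Q nT <-] sT|P nT].
  apply: nT => b Tb; have [a [n ab]] := phi_surj b.
  have /pset_prime[/(@notin_g Q 1) //|] : contract Q (g * a).
    by apply: sT; exists a => //; exists b => //; exists n.
  by rewrite mem_contract -ab => /pset_prime[/notin_g|].
have Pg : ~ P g.
  by move=> Pg; apply: nT => _ [a _ <-]; exact: primeMr.
exists (extend Pg); last exact: contract_extend.
move=> sT; apply: nT => _ [a [b Tb [n ab]] <-]; apply: primeMl.
exact/(mem_extend Pg ab)/(sT b).
Qed.

Section StalkIso.
Variables (P : spec A) (Q : spec B) (PQ : forall a, P a <-> Q (phi a)).

Lemma stalk_map_inj : injective (stalk_map PQ).
Proof.
suff inj0 x : stalk_map PQ x = 0 -> x = 0 by exact: raddf_inj.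
have [a [s [hs ->]]] := fracP x.
rewrite stalk_mapE -(frac0 (stalk_map_subproof PQ hs)) => /frac_eqP[w Qw].
have [c [n cw]] := phi_surj w; rewrite mul0r mulr0 -rmorphM => e.
have [k ek] : exists k, g ^+ k * (c * (a * s)) = g ^+ k * 0.
  by apply: phi_inj; rewrite rmorphM -cw -mulrA e mulr0 rmorph0.
rewrite -(frac0 hs); apply/frac_eqP; exists (g ^+ k * c).
  rewrite /= PQ rmorphM -cw; apply: notin_primeM; first exact: notin_g.
  by apply: notin_primeM => //; exact: notin_g.
by rewrite -mulrA ek mul0r !mulr0.
Qed.

(** With b = a / g^n and k = c / g^m, the fraction b / k is g^m a / (g^n c). The formula does not
    depend on [P] and [Q], so it describes a section on a whole neighbourhood. *)
Lemma stalk_map_frac b k (hk : prime_compl Q k) a n c m :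
    phi (g ^+ n) * b = phi a -> phi (g ^+ m) * k = phi c ->
  exists hc : prime_compl P (g ^+ n * c),
    stalk_map PQ (frac (g ^+ m * a) hc) = frac b hk.
Proof.
move=> ab ck.
have Pc : prime_compl P (g ^+ n * c).
  rewrite /= PQ rmorphM -ck; apply: notin_primeM; first exact: notin_g.
  by apply: notin_primeM => //; exact: notin_g.
exists Pc; rewrite stalk_mapE; apply/frac_eqP.
exists 1; first exact: mulset1.
by rewrite !rmorphM -ab -ck; ring.
Qed.

Lemma stalk_map_surj y : exists x, stalk_map PQ x = y.
Proof.
have [b [k [hk ->]]] := fracP y.
have [a [n ab]] := phi_surj b; have [c [m ck]] := phi_surj k.
by have [hc <-] := stalk_map_frac hk ab ck; exists (frac (g ^+ m * a) hc).
Qed.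

End StalkIso.

Lemma pull_subproof (V : set (spec A)) (s : sections V) :
  locally_fraction (fun Q (VQ : (contract @^-1` V) Q) =>
    stalk_map (mem_contract Q) (s (contract Q) VQ)).
Proof.
move=> Q VQ; have [W [a [k [oW WQ hs]]]] := sec_locally s VQ.
exists (contract @^-1` W), (phi a), (phi k); split=> //.
  by have /continuousP := contract_continuous; apply.
move=> Q' VQ' WQ'; have [hk ->] := hs (contract Q') VQ' WQ'.
by rewrite stalk_mapE; exists (stalk_map_subproof (mem_contract Q') hk).
Qed.

Definition pull (V : set (spec A)) (s : sections V) : sections (contract @^-1` V) :=
  Sections (pull_subproof s).

Lemma pull_is_zmod_morphism V : zmod_morphism (@pull V).
Proof. by move=> s t; apply: sec_ext => Q VQ; exact: rmorphB. Qed.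

Lemma pull_is_monoid_morphism V : monoid_morphism (@pull V).
Proof.
by split=> [|s t]; apply: sec_ext => Q VQ; [exact: rmorph1 | exact: rmorphM].
Qed.

HB.instance Definition _ V := GRing.isZmodMorphism.Build
  (sections V) (sections (contract @^-1` V)) (@pull V) (@pull_is_zmod_morphism V).
HB.instance Definition _ V := GRing.isMonoidMorphism.Build
  (sections V) (sections (contract @^-1` V)) (@pull V) (@pull_is_monoid_morphism V).

(** The maps of stalks are bijective. Their inverses assemble into a section, since [contract] is
    open and [stalk_map_frac] turns one local fraction into another. *)
Lemma pull_bij (V : set (spec A)) : (forall P, V P -> ~ P g) -> bijective (@pull V).
Proof.
move=> Vg.
have ext_contract Q (Pg : ~ contract Q g) : extend Pg = Q.
  by apply: contract_inj; exact: contract_extend.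
have pull_inj : injective (@pull V).
  move=> s t st; apply: sec_ext => P VP.
  (* [contract (extend _)] equals [P] only propositionally, so the equality of values in the
     dependent family of stalks has to be moved along this equation. *)
  have transport P' (VP' : V P') : P' = P -> s P' VP' = t P' VP' -> s P VP = t P VP.
    by move=> eP; case: _ / eP VP => VP; rewrite (Prop_irrelevance VP VP').
  have VQ : V (contract (extend (Vg P VP))) by rewrite contract_extend.
  have := congr1 (fun u : sections _ => u (extend (Vg P VP)) VQ) st.
  by move=> /= /stalk_map_inj; apply: transport; exact: contract_extend.
have pull_surj (t : sections (contract @^-1` V)) : exists s, pull s = t.
  have VQ P (VP : V P) : (contract @^-1` V) (extend (Vg P VP)).
    by rewrite /= contract_extend.
  pose s0 P (VP : V P) : stalk P :=
    sval (cid (stalk_map_surj (extendP (Vg P VP)) (t _ (VQ P VP)))).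
  have s0P P VP : stalk_map (extendP (Vg P VP)) (s0 P VP) = t _ (VQ P VP).
    by rewrite /s0; case: cid.
  have ls : locally_fraction s0.
    move=> P VP; have [W [b [k [oW WP tb]]]] := sec_locally t (VQ P VP).
    have [a [n ab]] := phi_surj b; have [c [m ck]] := phi_surj k.
    exists (contract @` W), (g ^+ m * a), (g ^+ n * c); split.
    - exact: contract_open_map.
    - by exists (extend (Vg P VP)); rewrite ?contract_extend.
    - move=> P' VP' [Q WQ QP'].
      have WP' : W (extend (Vg P' VP')).
        suff -> : extend (Vg P' VP') = Q by [].
        by apply: contract_inj; rewrite contract_extend.
      have [hk tbk] := tb _ (VQ P' VP') WP'.
      have [hc e] := stalk_map_frac (extendP (Vg P' VP')) hk ab ck.
      exists hc; apply: (@stalk_map_inj _ _ (extendP (Vg P' VP'))).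
      by rewrite e -tbk; exact: s0P.
  exists (Sections ls); apply: sec_ext => Q VQ' /=.
  have transport (Q' : spec B) z (PQ : forall a, contract Q a <-> Q' (phi a))
      (VQ'' : V (contract Q')) : Q' = Q -> stalk_map PQ z = t Q' VQ'' ->
      stalk_map (mem_contract Q) z = t Q VQ'.
    move=> eQ; subst Q'.
    by rewrite (Prop_irrelevance PQ (mem_contract Q)) (Prop_irrelevance VQ'' VQ').
  by apply: transport (s0P (contract Q) VQ'); exact: ext_contract.
have [psi psiK] := choice pull_surj.
by exists psi => // s; apply: pull_inj; rewrite psiK.
Qed.

Lemma basic_open_affine_of_localization : affine_open [set P : spec A | ~ P g].
Proof.
exists B, contract, (fun V _ _ => @pull V : {rmorphism _ -> _}); split.
- by split; [exact: contract_continuous | exact: contract_open_map].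
- by split; [exact: contract_inj | exact: range_contract].
- by move=> V _ Vg; exact: pull_bij.
- move=> V oV Vg W oW Wg WV s; apply: sec_ext => Q WQ /=.
  by congr (stalk_map _ (s _ _)); exact: Prop_irrelevance.
Qed.

End BasicOpenAffine.

Lemma basic_open_affine (A : comPzRingType) (g : A) :
  affine_open [set P : spec A | ~ P g].
Proof.
apply: (@basic_open_affine_of_localization _ _ (to_loc (powers g))).
- by exists (frac 1 (mem_powers g 1)); rewrite mulrC; exact: denMinv.
- move=> b; have [a [s [hs ->]]] := fracP b; have [n en] := hs.
  by exists a, n; rewrite -en; exact: fracMden.
- by move=> a a' /to_loc_eqP[_ [n ->] e]; exists n.
Qed.

(** * Gauss' lemma *)

Section PrimeFactorization.
Variable R : idomainType.
Implicit Types (a b c p q u : R) (s : seq R).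

Lemma divides_mull a b c : divides a b -> divides a (c * b).
Proof. by move=> [d ->]; exists (c * d); rewrite mulrA. Qed.

Lemma divides_mulr a b c : divides a b -> divides a (b * c).
Proof. by rewrite mulrC; exact: divides_mull. Qed.

Lemma divides0 a : divides a 0.
Proof. by exists 0; rewrite mul0r. Qed.

Lemma divides_refl a : divides a a.
Proof. by exists 1; rewrite mul1r. Qed.

Lemma dividesD a b c : divides a b -> divides a c -> divides a (b + c).
Proof. by move=> [d ->] [e ->]; exists (d + e); rewrite mulrDl. Qed.

Lemma dividesB a b c : divides a b -> divides a c -> divides a (b - c).
Proof. by move=> [d ->] [e ->]; exists (d - e); rewrite mulrBl. Qed.

Lemma prime_ndivides1 p : prime_elt p -> ~ divides p 1.
Proof.
move=> [_ pU _] [c c1]; case/negP: pU; apply/unitrPr; exists c.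
by rewrite mulrC.
Qed.

Lemma prime_divides_prod p s : prime_elt p ->
  divides p (\prod_(q <- s) q) -> exists2 q, q \in s & divides p q.
Proof.
move=> pP; elim: s => [|q s IH]; first by rewrite big_nil => /(prime_ndivides1 pP).
rewrite big_cons; have [_ _ pM] := pP.
case/pM=> [pq|/IH[r rs pr]]; first by exists q; rewrite ?mem_head.
by exists r; rewrite // inE rs orbT.
Qed.

Lemma prime_dividesX p a n : prime_elt p -> divides p (a ^+ n) -> divides p a.
Proof.
move=> pP; elim: n => [|n IH]; first by rewrite expr0 => /(prime_ndivides1 pP).
by rewrite exprS; have [_ _ pM] := pP; case/pM.
Qed.

Lemma prime_divides_associated p q :
  prime_elt p -> prime_elt q -> divides p q -> associated p q.
Proof.
move=> pP [q0 _ qM] [w qw].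
have /qM[[v ev]|[v ev]] : divides q (w * p) by rewrite -qw; exact: divides_refl.
  case: (prime_ndivides1 pP); exists v; apply: (mulIf q0).
  by rewrite mul1r [in LHS]qw ev; ring.
exists w => //; apply/unitrPr; exists v; apply: (mulIf q0).
by rewrite mul1r -mulrA -ev -qw.
Qed.

Definition prime_factorable a := exists2 u, u \is a GRing.unit &
  exists2 s, (forall p, p \in s -> prime_elt p) & a = u * \prod_(p <- s) p.

(** Existence of factorizations into primes, up to a unit, is the form of factoriality that is
    passed on to polynomials; uniqueness is implicit in it. *)
Definition prime_factorization := forall a, a != 0 -> prime_factorable a.

Lemma prime_factorableM a b :
  prime_factorable a -> prime_factorable b -> prime_factorable (a * b).
Proof.
move=> [u uU [s sP ->]] [v vU [t tP ->]]; exists (u * v).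
  by rewrite unitrM uU.
exists (s ++ t); last by rewrite big_cat /= mulrACA.
by move=> p; rewrite mem_cat => /orP[/sP|/tP].
Qed.

Lemma prime_factorable_unit u : u \is a GRing.unit -> prime_factorable u.
Proof. by move=> uU; exists u => //; exists [::]; rewrite // big_nil mulr1. Qed.

Lemma prime_factorable_prime p : prime_elt p -> prime_factorable p.
Proof.
move=> pP; exists 1; first exact: unitr1.
exists [:: p]; last by rewrite big_seq1 mul1r.
by move=> q; rewrite inE => /eqP->.
Qed.

(** Cancelling a prime lowers the number of prime factors by one, which is the measure of later
    inductions. *)
Lemma prime_factors_rem p b u s : prime_elt p -> u \is a GRing.unit ->
    (forall q, q \in s -> prime_elt q) -> b * p = u * \prod_(q <- s) q ->
  exists2 v, v \is a GRing.unit & exists t, [/\ size s = (size t).+1,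
    (forall q, q \in t -> prime_elt q) & b = v * \prod_(q <- t) q].
Proof.
move=> pP uU sP e; have p0 : p != 0 by case: pP.
have pu : divides p (\prod_(q <- s) q).
  exists (u^-1 * b); apply: (mulrI uU); rewrite -e -mulrA mulVKr //.
have [q qs pq] := prime_divides_prod pP pu.
have [w wU qw] := prime_divides_associated pP (sP q qs) pq.
exists (u * w); first by rewrite unitrM uU.
exists (rem q s); split.
- by rewrite size_rem // prednK //; case: (s) qs.
- by move=> r /mem_rem; exact: sP.
- apply: (mulIf p0); rewrite e (perm_big _ (perm_to_rem qs)) big_cons /= qw.
  by ring.
Qed.

(** Uniqueness, applied to the factorizations of [p * c] and of [a * b], makes [p] an associate of a
    factor of [a] or of [b]. *)
Lemma factorial_irreducible_prime p :
  factorial_domain R -> irreducible_elt p -> prime_elt p.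
Proof.
move=> [fac uniq] irr; have [p0 pU _] := irr; split=> // a b [c ec].
have fac' z : z != 0 -> exists2 u, u \is a GRing.unit &
    exists2 s, (forall q, q \in s -> irreducible_elt q) & z = u * \prod_(q <- s) q.
  move=> z0; have [zU|zU] := boolP (z \is a GRing.unit).
    by exists z => //; exists [::]; rewrite // big_nil mulr1.
  have [s sI ->] := fac z z0 zU; exists 1; first exact: unitr1.
  by exists s; rewrite ?mul1r.
have [->|a0] := eqVneq a 0; first by left; exact: divides0.
have [->|b0] := eqVneq b 0; first by right; exact: divides0.
have c0 : c != 0.
  by apply: contra_eq_neq ec => ->; rewrite mul0r mulf_neq0.
have [u uU [s sI ea]] := fac' a a0; have [v vU [t tI eb]] := fac' b b0.
have [w wU [r rI ew]] := fac' c c0.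
have [||| st [prm sz assoc]] := uniq (p :: r) (s ++ t).
- by move=> q; rewrite inE => /orP[/eqP->|/rI].
- by move=> q; rewrite mem_cat => /orP[/sI|/tI].
- exists ((u * v)^-1 * w); first by rewrite unitrM unitrV unitrM uU vU.
  have uvU : u * v \is a GRing.unit by rewrite unitrM uU.
  apply: (mulrI uvU); rewrite big_cat big_cons /= !mulrA divrr // mul1r.
  transitivity (a * b); first by rewrite ea eb; ring.
  by rewrite ec ew; ring.
have [x _ ex] := assoc 0%N isT.
have : st`_0 \in s ++ t by rewrite (perm_mem prm) mem_nth // -sz.
have div q k z : q \in k -> divides p q -> divides p (z * \prod_(q <- k) q).
  by move=> qk pq; rewrite (big_rem q) //=; apply/divides_mull/divides_mulr.
have px : divides p st`_0 by rewrite ex; apply: divides_mull; exact: divides_refl.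
by rewrite mem_cat => /orP[?|?]; [left; rewrite ea | right; rewrite eb]; exact: div px.
Qed.

Lemma factorial_prime_factorization : factorial_domain R -> prime_factorization.
Proof.
move=> fR a a0; have [aU|aU] := boolP (a \is a GRing.unit).
  exact: prime_factorable_unit.
have [s sI ->] := fR.1 a a0 aU; exists 1; first exact: unitr1.
exists s; last by rewrite mul1r.
by move=> p /sI; exact: factorial_irreducible_prime.
Qed.

End PrimeFactorization.

(** * Factoriality of polynomial rings *)

Section Gauss.
Variable R : idomainType.
Implicit Types (c u : R) (p q g h m : {poly R}).

Lemma divides_polyC u p : divides u%:P p <-> forall i, divides u p`_i.
Proof.
split=> [[q ->] i|up]; first by exists q`_i; rewrite coefMC.
have [c cu] := choice up; exists (\poly_(i < size p) c i); apply/polyP => i.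
rewrite coefMC coef_poly; case: ltnP => [_|le]; first exact: cu.
by rewrite mul0r nth_default.
Qed.

(** If [i] and [j] are the first indices at which [u] fails to divide a coefficient of [p] and of
    [q], then the coefficient of [p * q] at [i + j] is the product of these two modulo [u]. *)
Lemma prime_polyC u : prime_elt u -> prime_elt u%:P.
Proof.
move=> uP; have [u0 uU uM] := uP; split; first by rewrite polyC_eq0.
  by rewrite poly_unitE coefC eqxx negb_and uU orbT.
have first_ndiv p : ~ divides u%:P p ->
    exists2 i, ~ divides u p`_i & forall j, (j < i)%N -> divides u p`_j.
  move=> /divides_polyC np.
  have ex : exists i, `[< ~ divides u p`_i >].
    apply: contrapT => h; apply: np => i; apply: contrapT => ni.
    by apply: h; exists i; apply/asboolP.
  have [i /asboolP ni imin] := ex_minnP ex; exists i => // j ji.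
  by apply: contrapT => /asboolP /imin; rewrite leqNgt ji.
move=> p q /divides_polyC upq.
apply: contrapT => /not_orP[/first_ndiv[i ni ilt] /first_ndiv[j nj jlt]].
have := upq (i + j)%N; rewrite coefM.
have lt_i : (i < (i + j).+1)%N by rewrite ltnS leq_addr.
rewrite (bigD1 (Ordinal lt_i)) //= addKn => h.
suff /uM[/ni|/nj] : divides u (p`_i * q`_j) by [].
rewrite -[X in divides _ X](addrK (\sum_(k < (i + j).+1 | k != Ordinal lt_i)
  p`_k * q`_(i + j - k))).
apply: dividesB => //; elim/big_ind: _ => [|x y|k ki]; first exact: divides0.
  exact: dividesD.
have {ki} : (k != i :> nat) by [].
rewrite neq_ltn => /orP[ki|ik]; first exact/divides_mulr/ilt.
by apply/divides_mull/jlt; have := ltn_ord k; lia.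
Qed.

Definition primitive_poly p := forall u, prime_elt u -> ~ divides u%:P p.

Hypothesis facR : prime_factorization R.

Lemma prime_factorable_polyC c : c != 0 -> prime_factorable c%:P.
Proof.
move=> /facR[u uU [s sP ->]]; exists u%:P; first exact: rmorph_unit.
exists [seq v%:P | v <- s].
  by move=> _ /mapP[v vs ->]; exact/prime_polyC/sP.
by rewrite polyCM rmorph_prod big_map.
Qed.

(** The prime factors [v] of [c] are removed one at a time: [v] divides [q * p] but not the
    primitive [p], so it divides the cofactor [q]. *)
Lemma gauss_primitive p c h :
  primitive_poly p -> c != 0 -> divides p (c%:P * h) -> divides p h.
Proof.
move=> pp /facR[u uU [s sP ->]]; elim: s h sP => [|v s IH] h sP.
  rewrite big_nil mulr1 => /(divides_mull u^-1%:P).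
  by rewrite mulrA -polyCM mulVr // mul1r.
have vP : prime_elt v by apply: sP; rewrite mem_head.
rewrite big_cons => -[q]; rewrite mulrCA polyCM -mulrA => e.
have [v0 _ vM] := prime_polyC vP.
have /vM[[q' eq]|/(pp v vP) //] : divides v%:P (q * p).
  by rewrite -e; apply/divides_mulr/divides_refl.
apply: IH; first by move=> w ws; apply: sP; rewrite inE ws orbT.
by exists q'; apply: (mulfI v0); rewrite e eq; ring.
Qed.

(** Induction on the number of prime factors of the leading coefficient, which drops whenever a
    prime constant is divided out. *)
Lemma primitive_part p : p != 0 ->
  exists2 c, c != 0 & exists2 q, primitive_poly q & p = c%:P * q.
Proof.
move=> p0; have /facR[u uU [s sP es]] : lead_coef p != 0 by rewrite lead_coef_eq0.
elim: {s}(size s) {-2}s (erefl (size s)) p u uU p0 sP es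
  => [|n IH] s sn p u uU p0 sP es.
  exists 1; first exact: oner_neq0.
  exists p; last by rewrite mul1r.
  move=> v vP [q pq]; have [_ vU _] := vP; case/negP: vU.
  have := congr1 lead_coef pq; rewrite lead_coefM lead_coefC es (size0nil sn).
  by rewrite big_nil mulr1 => e; move: uU; rewrite e unitrM => /andP[].
have [pp|npp] := pselect (primitive_poly p).
  by exists 1; [exact: oner_neq0 | exists p; rewrite ?mul1r].
have [v [vP [q pq]]] : exists v, prime_elt v /\ divides v%:P p.
  by apply: contrapT => h; apply: npp => v vP vp; apply: h; exists v.
have := congr1 lead_coef pq; rewrite lead_coefM lead_coefC es => e.
have q0 : q != 0 by apply: contra_eq_neq pq => ->; rewrite mul0r.
have [w wU [t [st tP et]]] := prime_factors_rem vP uU sP (esym e).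
have stn : size t = n by move: st; rewrite sn => -[].
have [c c0 [r rp er]] := IH t stn q w wU q0 tP et.
exists (v * c); first by rewrite mulf_neq0 //; case: vP.
by exists r; rewrite // pq er polyCM; ring.
Qed.

(** The Euclidean argument over the fraction field, by pseudo-division. The primitive part [m'] of
    an element of least degree in the ideal [(p, g)] divides [p] and [g]. If [m'] is constant, [p]
    divides a constant times [h]; otherwise p / m' is constant and [p] divides a constant times [g].
    Gauss removes the constants. *)
Lemma primitive_irreducible_prime p : primitive_poly p -> (1 < size p)%N ->
    (forall g h, p = g * h -> (size p <= size g)%N \/ (size p <= size h)%N) ->
  prime_elt p.
Proof.
move=> pp p1 irr; have p0 : p != 0 by rewrite -size_poly_gt0 ltnW.
split=> // [|g h pgh].
  by rewrite poly_unitE negb_and neq_ltn p1 orbT.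
apply: contrapT => /not_orP[npg nph].
pose I m := exists a b, m = a * p + b * g.
have ex : exists n, `[< exists m, [/\ I m, m != 0 & size m = n] >].
  by exists (size p); apply/asboolP; exists p; split=> //; exists 1, 0; ring.
have [n /asboolP[m [Im m0 mn]] nmin] := ex_minnP ex.
have [c c0 [m' mp em]] := primitive_part m0.
have mI z : I z -> divides m' z.
  (* Here [k] is the power of the leading coefficient of [m] by which pseudo-division multiplies
     [z]; the remainder vanishes since [m] has least degree. *)
  move=> [a [b ez]]; have := Pdiv.Idomain.divp_eq z m.
  set k := _ ^+ _; have [<-|r0] := eqVneq 0 (z %% m); last first.
    move=> e; have := nmin (size (z %% m)).
    rewrite -mn leqNgt ltn_modp m0 => min; suff: false by []; apply: min.
    apply/asboolP; exists (z %% m); split; rewrite // 1?eq_sym //.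
    have [a' [b' em']] := Im; exists (k%:P * a - z %/ m * a'), (k%:P * b - z %/ m * b').
    by apply: (addrI (z %/ m * m)); rewrite -e -mul_polyC ez [in RHS]em'; ring.
  rewrite addr0 -mul_polyC em => e; apply: (@gauss_primitive _ k) => //.
    by rewrite expf_neq0 // lead_coef_eq0.
  by rewrite e; do 2!apply: divides_mull; exact: divides_refl.
have [q eq] : divides m' p by apply: mI; exists 1, 0; ring.
have [g' eg] : divides m' g by apply: mI; exists 0, 1; ring.
have m'0 : m' != 0 by apply: contra_neq m0 => e; rewrite em e mulr0.
have q0 : q != 0 by apply: contra_eq_neq eq => ->; rewrite mul0r.
have szp : size p = (size q + size m').-1 by rewrite [in LHS]eq size_mul.
have sq : (0 < size q)%N by rewrite size_poly_gt0.
have sm : (0 < size m')%N by rewrite size_poly_gt0.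
have [le|le] := irr q m' eq.
  have /size_poly1P[d d0 ed] : size m' == 1%N by apply/eqP; lia.
  have [a [b eab]] := Im; apply: nph; apply: (@gauss_primitive p (c * d)) => //.
    by rewrite mulf_neq0.
  rewrite polyCM -ed -em eab mulrDl; apply: dividesD.
    by apply: divides_mulr; apply: divides_mull; exact: divides_refl.
  by rewrite -mulrA; exact: divides_mull.
have /size_poly1P[d d0 ed] : size q == 1%N by apply/eqP; lia.
apply: npg; apply: (@gauss_primitive p d) => //.
by exists g'; rewrite -ed eq eg; ring.
Qed.

(** The content factors in [R]. A primitive polynomial is a unit if constant, and prime if it is not
    a product of polynomials of smaller degree; otherwise induction applies to both factors. *)
Theorem gauss_prime_factorization : prime_factorization {poly R}.
Proof.
move=> p; elim: {p}(size p) {-2}p (leqnn (size p)) => [|n IH] p sp p0.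
  by move: p0; rewrite -size_poly_gt0 ltnNge sp.
have [c c0 [q qp e]] := primitive_part p0.
rewrite e; apply: prime_factorableM; first exact: prime_factorable_polyC.
have q0 : q != 0 by apply: contra_neq p0 => eq; rewrite e eq mulr0.
have szq : size q = size p by rewrite e mul_polyC size_scale.
have [q1|q1] := leqP (size q) 1.
  have /size_poly1P[d d0 ed] : size q == 1%N.
    by rewrite eqn_leq q1 size_poly_gt0.
  apply: prime_factorable_unit; rewrite ed.
  have [u uU [[|v s] sP es]] := facR d0.
    by rewrite es big_nil mulr1; exact: rmorph_unit.
  case: (qp v); first by apply: sP; rewrite mem_head.
  by rewrite ed es big_cons mulrCA polyCM; apply/divides_mulr/divides_refl.
have [irr|] := pselect (forall g h, q = g * h ->
    (size q <= size g)%N \/ (size q <= size h)%N).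
  exact/prime_factorable_prime/primitive_irreducible_prime.
move=> red; have [g [h [eq gq hq]]] : exists g h,
    [/\ q = g * h, (size g < size q)%N & (size h < size q)%N].
  apply: contrapT => nex; apply: red => g h egh.
  case: (leqP (size q) (size g)) => [|lg]; first by left.
  by case: (leqP (size q) (size h)) => [|lh]; [right | case: nex; exists g, h].
have g0 : g != 0 by apply: contra_neq q0 => ez; rewrite eq ez mul0r.
have h0 : h != 0 by apply: contra_neq q0 => ez; rewrite eq ez mulr0.
by rewrite eq; apply: prime_factorableM; apply: IH => //; lia.
Qed.

End Gauss.

(** * Divisors on a domain with discrete valuation rings at height one *)

Section HeightOne.
Variable A : comNzRingType.
Implicit Types P Q : spec A.

Lemma height_one_nonzero P : height_one P -> exists2 a, P a & a <> 0.
Proof.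
move=> [[Q [QP PQ]] _]; apply: contrapT => h; apply: PQ => a Pa.
have [-> |a0] := pselect (a = 0); first exact: prime0.
by case: h; exists a.
Qed.

Lemma height_one_minimal P Q : height_one P -> height_one Q ->
  pset P `<=` pset Q -> P = Q.
Proof.
move=> [[Q1 Q1P] _] [_ hQ] PQ; apply: spec_ext => a; split; first exact: PQ.
move=> Qa; apply: contrapT => Pa; apply: hQ; exists Q1, P; split=> //.
by split=> // /(_ a Qa).
Qed.

Lemma prime_divisor_eq (P Q : prime_divisor A) : pset P `<=` pset Q -> P = Q.
Proof.
move=> PQ; have := height_one_minimal (pd_height_one P) (pd_height_one Q) PQ.
case: P Q {PQ} => [P hP] [Q hQ] /= e; case: _ / e hQ => hQ.
by rewrite (Prop_irrelevance hP hQ).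
Qed.

End HeightOne.

Section DvrPrimes.
Variable A : comNzRingType.
Hypothesis domA : forall a b : A, a * b = 0 -> a = 0 \/ b = 0.
Implicit Types (P Q : spec A) (a b s t : A).

Lemma domain_lreg a : a <> 0 -> GRing.lreg a.
Proof.
move=> a0 x y e; have /domA[//|] : a * (x - y) = 0 by rewrite mulrBr e subrr.
by move=> /eqP; rewrite subr_eq0 => /eqP.
Qed.

Lemma notin_prime_neq0 P a : ~ P a -> a <> 0.
Proof. by move=> Pa a0; apply: Pa; rewrite a0; exact: prime0. Qed.

Lemma domain_mul_neq0 a b : a <> 0 -> b <> 0 -> a * b <> 0.
Proof. by move=> a0 b0 /domA[]. Qed.

Lemma domain_exp_neq0 a n : a <> 0 -> a ^+ n <> 0.
Proof.
move=> a0; elim: n => [|n IH]; first by apply/eqP; exact: oner_neq0.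
by rewrite exprS; exact: domain_mul_neq0.
Qed.

(* [a] is a unit of the local ring at [P] times [t ^+ n]. *)
Definition order_of P t a n :=
  exists s b, [/\ ~ P s, ~ P b & s * a = t ^+ n * b].

(** The local ring at [P] is a discrete valuation ring with uniformizer [t], expressed in [A]
    without fractions. *)
Definition dvr_at P t :=
  [/\ P t, t <> 0 & forall a, a <> 0 -> exists n, order_of P t a n].

Lemma order_of0 P t a : ~ P a -> order_of P t a 0.
Proof.
by exists 1, a; split; rewrite ?expr0 //; exact: pset_proper.
Qed.

Lemma order_of0_notin P t a : order_of P t a 0 -> ~ P a.
Proof.
move=> [s [b [Ps Pb e]]] Pa; apply: Pb.
by rewrite -[b]mul1r -(expr0 t) -e; exact: primeMl.
Qed.

Lemma order_of_mem P t a n : P t -> order_of P t a n.+1 -> P a.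
Proof.
move=> Pt [s [b [Ps Pb e]]]; have : P (s * a) by rewrite e exprS -mulrA; exact: primeMr.
by case/pset_prime.
Qed.

Lemma order_of_unique P t a m n : P t -> t <> 0 ->
  order_of P t a m -> order_of P t a n -> m = n.
Proof.
move=> Pt t0; wlog mn : m n / (m <= n)%N => [wl hm hn|].
  by have [mn|/ltnW nm] := leqP m n; [exact: wl | apply/esym; exact: wl].
move=> [s [b [Ps Pb e]]] [s' [b' [Ps' Pb' e']]].
have e2 : t ^+ m * (s' * b) = t ^+ m * (t ^+ (n - m) * (s * b')).
  rewrite [RHS]mulrA -exprD subnKC //.
  transitivity (s' * (t ^+ m * b)); first by ring.
  by rewrite -e; transitivity (s * (t ^+ n * b')); [rewrite -e'; ring | ring].
have := domain_lreg (domain_exp_neq0 (n := m) t0) e2.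
move: mn; rewrite leq_eqVlt => /orP[/eqP //|]; rewrite -subn_gt0.
case: (n - m)%N => // k _ e3; case: (notin_primeM Ps' Pb).
by rewrite e3 exprS -mulrA; exact: primeMr.
Qed.

Lemma order_ofM P t a b m n :
  order_of P t a m -> order_of P t b n -> order_of P t (a * b) (m + n).
Proof.
move=> [s [c [Ps Pc e]]] [s' [c' [Ps' Pc' e']]]; exists (s * s'), (c * c').
split; [exact: notin_primeM | exact: notin_primeM |].
by rewrite mulrACA e e' exprD mulrACA.
Qed.

Lemma order_of_gen P t : order_of P t t 1.
Proof.
by exists 1, 1; split; rewrite ?mul1r ?mulr1 ?expr1 //; exact: pset_proper.
Qed.

Lemma order_ofX P t a m n : order_of P t a m -> order_of P t (a ^+ n) (m * n).
Proof.
move=> am; elim: n => [|n IH]; first by rewrite muln0; apply/order_of0/pset_proper.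
by rewrite exprS mulnS; exact: order_ofM.
Qed.

Lemma exists_zero_prime : exists Z : spec A, forall a, Z a <-> a = 0.
Proof.
have zI : is_ideal [set a : A | a = 0].
  split=> [|a b /= -> ->|a b /= ->] //; first by rewrite addr0.
  by rewrite mulr0.
have z1 : ~ [set a : A | a = 0] 1 by apply/eqP; exact: oner_neq0.
by exists (Spec zI z1 domA).
Qed.

(** A nonzero prime inside [P] contains some t^n b with [b] outside [P], hence [t], hence every
    element of [P]. *)
Lemma dvr_height_one P t : dvr_at P t -> height_one P.
Proof.
move=> [Pt t0 ordP]; split.
  have [Z Z0] := exists_zero_prime; exists Z; split=> [a /Z0 ->|/(_ t Pt)/Z0 //].
  exact: prime0.
move=> [Q1 [Q2 [[Q12 nQ21] [Q2P nPQ2]]]].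
have [a [Q2a a0]] : exists a, Q2 a /\ a <> 0.
  apply: contrapT => h; apply: nQ21 => a Q2a.
  have [-> |a0] := pselect (a = 0); first exact: prime0.
  by case: h; exists a.
have Q2t : Q2 t.
  have [n [s [b [Ps Pb e]]]] := ordP a a0.
  have : Q2 (t ^+ n * b) by rewrite -e; exact: primeMl.
  by case/pset_prime => [/primeX //|/Q2P /Pb].
apply: nPQ2 => c Pc; have [-> |c0] := pselect (c = 0); first exact: prime0.
have [n cn] := ordP c c0; case: n cn => [/order_of0_notin //|n].
move=> [s [b [Ps Pb e]]].
have : Q2 (s * c) by rewrite e exprS -mulrA; exact: primeMr.
by case/pset_prime=> // /Q2P /Ps.
Qed.

Lemma stalk_lreg P a : a <> 0 -> GRing.lreg (to_loc (prime_compl P) a).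
Proof.
move=> a0 x y; have [b [s [Ps ->]]] := fracP x; have [c [r [Pr ->]]] := fracP y.
rewrite !fracM => /frac_eqP[w Pw e]; apply/frac_eqP; exists 1; first exact: mulset1.
rewrite !mul1r; apply: (domain_lreg (domain_mul_neq0 (notin_prime_neq0 Pw) a0)).
transitivity (w * (a * b * (1 * r))); first by ring.
by rewrite e; ring.
Qed.

Lemma frac_unit P b s (Ps : prime_compl P s) (Pb : prime_compl P b) :
  frac s Pb * frac b Ps = 1.
Proof.
rewrite fracM -(frac1 (mulset1 (prime_compl P))); apply/frac_eqP.
by exists 1; [exact: mulset1 | ring].
Qed.

Lemma frac_unit_num P b s (Ps : prime_compl P s) :
  (exists v, v * frac b Ps = 1) -> ~ P b.
Proof.
move=> [v v1].
have [c Pcb] : exists c, prime_compl P (c * b).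
  apply/loc_unitP; exists (v * frac 1 Ps); rewrite -(fracMden b Ps).
  transitivity (v * frac b Ps * (to_loc (prime_compl P) s * frac 1 Ps)); first by ring.
  by rewrite v1 denMinv mulr1.
by move=> Pb; apply: Pcb; exact: primeMl.
Qed.

(** By [dvr_at] the image of [t] generates the maximal ideal of the stalk; another generator differs
    from it by a unit because this image is not a zero divisor. *)
Lemma uniformizerP P t (x : stalk P) : dvr_at P t ->
  uniformizer x <-> exists2 u : stalk P, (exists v, v * u = 1) &
    to_loc (prime_compl P) t = u * x.
Proof.
move=> [Pt t0 ordP]; set T := to_loc (prime_compl P) t.
have maxE : [set x | exists (a s : A) (hs : prime_compl P s), P a /\ x = frac a hs] =
    [set y * T | y in [set: stalk P]].
  apply/seteqP; split=> [_ [a [s [Ps [Pa ->]]]]|_ [y _ <-]].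
    have [-> |a0] := pselect (a = 0); first by exists 0; rewrite // mul0r frac0.
    have [[/order_of0_notin //|n]] := ordP a a0.
    move=> [s' [b [Ps' Pb e]]].
    exists (@frac _ (prime_compl P) (t ^+ n * b) (s' * s) (notin_primeM Ps' Ps)) => //.
    rewrite fracM; apply/frac_eqP; exists 1; first exact: mulset1.
    transitivity (s * (t ^+ n.+1 * b)); first by rewrite exprS; ring.
    by rewrite -e; ring.
  have [c [s [Ps ->]]] := fracP y.
  exists (c * t), s, Ps; split; first exact: primeMl.
  by rewrite fracM; apply/frac_eqP; exists 1; [exact: mulset1 | ring].
rewrite /uniformizer maxE; split=> [eT|[u [v vu] Tu]].
  have [u _ uT] : [set y * x | y in [set: stalk P]] T.
    by rewrite -eT; exists 1; rewrite ?mul1r.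
  have [v _ vx] : [set y * T | y in [set: stalk P]] x.
    by rewrite eT; exists 1; rewrite ?mul1r.
  exists u => //; exists v; apply: (@stalk_lreg P t t0).
  rewrite -/T mulr1 -[in RHS]uT -vx.
  by ring.
apply/seteqP; split=> _ [y _ <-]; first by exists (y * u); rewrite // Tu mulrA.
by exists (y * v); rewrite // Tu -mulrA (mulrA v) vu mul1r.
Qed.

Lemma dvr_uniformizer P t : dvr_at P t -> uniformizer (to_loc (prime_compl P) t).
Proof.
move=> dP; apply/(uniformizerP _ dP).
by exists 1; [exists 1; rewrite mulr1 | rewrite mul1r].
Qed.

Lemma ord_atP (P : prime_divisor A) t a n :
  dvr_at P t -> ord_at P a n <-> order_of P t a n.
Proof.
move=> dP; split=> [/(_ _ (dvr_uniformizer dP))[u uU e]|].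
  have [c [k [Pk uE]]] := fracP u; rewrite uE in uU e.
  have Pc := frac_unit_num uU.
  have /to_loc_eqP[w Pw ew] : to_loc (prime_compl P) (k * a) =
      to_loc (prime_compl P) (t ^+ n * c).
    by rewrite !rmorphM rmorphXn /= e mulrA fracMden mulrC.
  by exists (w * k), (w * c); split;
    [exact: notin_primeM | exact: notin_primeM | rewrite -mulrA ew; ring].
move=> [s [b [Ps Pb e]]] x /(uniformizerP _ dP)[u [v vu] Tu].
exists (@frac _ (prime_compl P) b s Ps * u ^+ n).
  exists (@frac _ (prime_compl P) s b Pb * v ^+ n).
  by rewrite mulrACA frac_unit -exprMn vu expr1n mulr1.
rewrite -mulrA -exprMn -Tu -rmorphXn mulrC.
apply: (@to_loc_lreg _ (prime_compl P) s Ps).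
by rewrite mulrCA fracMden -!rmorphM e.
Qed.

End DvrPrimes.

(** * Divisors with a principal multiple *)

Section TorsionDivisors.
Variable A : comNzRingType.
Hypothesis domA : forall a b : A, a * b = 0 -> a = 0 \/ b = 0.
Hypothesis dvrA : forall P : prime_divisor A, exists t, dvr_at P t.
Hypothesis locA : forall a b : A, b <> 0 ->
  (forall P : prime_divisor A, exists s c, ~ P s /\ s * a = c * b) ->
  exists c, a = c * b.
Implicit Types (P : prime_divisor A) (a b c t : A) (D E : Div A).

Lemma principal_of_orders D a : a <> 0 ->
    (forall P, exists2 t, dvr_at P t &
       exists2 n, order_of P t a n & coeff P D = n%:Z) ->
  principal D.
Proof.
move=> a0 ordD; exists a, 1; split; [exact: domain_lreg | exact: lreg1 | move=> P].
have [t dP [n an ->]] := ordD P; exists n, 0%N.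
by split; rewrite ?subr0 //; [exact/(ord_atP domA _ _ dP) | exact: ord_at1].
Qed.

Lemma order_of_divides (P : spec A) t a b m n :
    order_of P t a m -> order_of P t b n -> (n <= m)%N ->
  exists s c, ~ P s /\ s * a = c * b.
Proof.
move=> [s [c [Ps Pc e]]] [s' [c' [Ps' Pc' e']]] nm.
exists (c' * s), (t ^+ (m - n) * c * s'); split; first exact: notin_primeM.
transitivity (c' * (s * a)); first by ring.
rewrite e -{1}(subnK nm) exprD.
transitivity (t ^+ (m - n) * c * (t ^+ n * c')); first by ring.
by rewrite -e'; ring.
Qed.

(* If [c] lay in a prime [Q] containing no component of [E], then a product of
   elements of the components outside [Q] would be a multiple of [c]. *)
Lemma supp_compl_of_orders E c (k : prime_divisor A -> nat) : c <> 0 ->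
    (forall P, exists2 t, dvr_at P t & order_of P t c (k P)) ->
    (forall P, (coeff P E == 0) = (k P == 0%N)) ->
  supp_compl E = [set Q | ~ Q c].
Proof.
move=> c0 ordc Ek; apply/seteqP; split=> Q /=; last first.
  move=> Qc [P EP PQ]; apply/Qc/PQ; have [t [Pt _ _] ct] := ordc P.
  by move: EP ct; rewrite Ek; case: (k P) => // n _; exact: order_of_mem.
move=> nE Qc.
have /choice[x xP] P : exists x, coeff P E != 0 -> P x /\ ~ Q x.
  have [EP|//] := boolP (coeff P E != 0); last by exists 0.
  apply: contrapT => h; apply: nE; exists P => // y Py.
  by apply: contrapT => Qy; apply: h; exists y.
pose z := \prod_(P <- dom E) x P ^+ k P.
have Qz : ~ Q z.
  rewrite /z big_seq; elim/big_ind: _ => [|u v|P]; first exact: pset_proper.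
    exact: notin_primeM.
  by rewrite mem_dom => /xP[_ Qx]; exact: notin_primeX.
have [|e ez] := locA (a := z) c0; last by apply: Qz; rewrite ez; exact: primeMl.
move=> P; have [t dP ct] := ordc P; have [Pt t0 ordP] := dP.
have [EP|EP] := eqVneq (coeff P E) 0.
  have /eqP kP : k P == 0%N by rewrite -Ek EP.
  by exists c, z; split; [apply: (@order_of0_notin _ P t); rewrite -kP | rewrite mulrC].
have [Px Qx] := xP P EP.
have [[/order_of0_notin //|n] xn] := ordP _ (notin_prime_neq0 Qx).
(* [x P] has order at least one at [P], so the exponent [k P] makes the order of [z] at least that
   of [c]. *)
have le : (k P <= n.+1 * k P)%N by rewrite leq_pmull.
have [s [d [Ps e]]] := order_of_divides (order_ofX (k P) xn) ct le.
exists s, (d * \prod_(P' <- rem P (dom E)) x P' ^+ k P'); split=> //.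
rewrite /z (big_rem P) ?mem_dom //= mulrA e; ring.
Qed.

Theorem torsion_strongly_coaffine D (n : int) :
  n <> 0 -> principal (D *~ n) -> strongly_coaffine D.
Proof.
move=> n0 prD; have {n n0 prD} [m m0 prD] : exists2 m, (0 < m)%N & principal (D *+ m).
  case: n n0 prD => m; first by exists m => //; lia.
  by rewrite NegzE mulrNz => _ /principalN; rewrite opprK; exists m.+1.
move=> k; left => E effE lE.
have [a [b [la lb div]]] : principal (E *+ m).
  have -> : E *+ m = (E - D *~ k) *~ m + (D *+ m) *~ k.
    by rewrite mulrzBl !pmulrn mulrzAC subrK.
  by apply: principalD; exact: principalMz.
have /eqP a0 := lreg_neq0 la; have /eqP b0 := lreg_neq0 lb.
have {}div P : exists2 t, dvr_at P t & exists i j, [/\ order_of P t a i,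
    order_of P t b j & (i = j + `|coeff P E| * m)%N].
  have [t dP] := dvrA P; have [i [j [ai bj e]]] := div P.
  move: ai bj => /(ord_atP domA _ _ dP) ai /(ord_atP domA _ _ dP) bj.
  exists t => //; exists i, j; split=> //; move: e (effE P).
  rewrite coeffMn; lia.
(* [E] is effective, so at each prime of height one the order of [a] is at least that of [b]. Hence
   a / b is an element [c] of [A], with divisor [E *+ m]. *)
have [|c ac] := locA (a := a) b0.
  move=> P; have [t dP [i [j [ai bj e]]]] := div P.
  by apply: order_of_divides ai bj _; rewrite e leq_addr.
have c0 : c <> 0 by move=> c0; apply: a0; rewrite ac c0 mul0r.
suff -> : supp_compl E = [set Q | ~ Q c] by exact: basic_open_affine.
apply: (@supp_compl_of_orders E c (fun P => `|coeff P E| * m)%N c0) => P; last first.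
  by rewrite muln_eq0 absz_eq0 (gtn_eqF m0) orbF.
have [t dP [i [j [ai bj e]]]] := div P; exists t => //; have [Pt t0 ordP] := dP.
have [n cn] := ordP c c0; suff <- : n = (`|coeff P E| * m)%N by [].
apply: (@addnI j); rewrite -e addnC; apply: (order_of_unique domA Pt t0 _ ai).
by rewrite ac; exact: order_ofM.
Qed.

End TorsionDivisors.

(** * The ring R[X,Y]/(XY - f) *)

Section Valuations.
Variable R : idomainType.
Implicit Types (a b c p q u x : R).

Lemma prime_valuation p a : prime_factorization R -> prime_elt p -> a != 0 ->
  exists n q, a = p ^+ n * q /\ ~ divides p q.
Proof.
move=> fac pP /fac[u uU [s sP ->]].
elim: {s}(size s) {-2}s (erefl (size s)) u uU sP => [|n IH] s sn u uU sP.
  exists 0%N, (u * \prod_(q <- s) q); split; first by rewrite expr0 mul1r.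
  rewrite (size0nil sn) big_nil mulr1 => -[c uc]; have [_ pU _] := pP; case/negP: pU.
  by move: uU; rewrite uc unitrM => /andP[].
have [[c e]|np] := pselect (divides p (u * \prod_(q <- s) q)); last first.
  by exists 0%N, (u * \prod_(q <- s) q); rewrite expr0 mul1r.
have [v vU [t [st tP et]]] := prime_factors_rem pP uU sP (esym e).
have stn : size t = n by move: st; rewrite sn => -[].
have [m [q [eq nq]]] := IH t stn v vU tP.
by exists m.+1, q; split=> //; rewrite e et eq exprS; ring.
Qed.

(** The prime factors of [b] are treated one by one: a factor dividing [x] is absorbed by one more
    power of [x], any other one divides [a] by the local hypothesis. *)
Lemma divides_of_local x a b : prime_factorization R -> b != 0 ->
    (forall p, prime_elt p -> ~ divides p x ->
       exists s c, ~ divides p s /\ s * a = c * b) ->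
  exists n c, x ^+ n * a = c * b.
Proof.
move=> fac /fac[u uU [s sP ->]]; elim: s sP a => [|q s IH] sP a loc.
  by exists 0%N, (a / u); rewrite big_nil mulr1 expr0 mul1r divrK.
have qP : prime_elt q by apply: sP; rewrite mem_head.
have sP' : forall p, p \in s -> prime_elt p.
  by move=> p ps; apply: sP; rewrite inE ps orbT.
have [q0 _ qM] := qP.
have [[w xw]|nqx] := pselect (divides q x).
  have [|n [c e]] := IH sP' a.
    move=> p pP px; have [t [c [pt e]]] := loc p pP px; exists t, (c * q).
    by split=> //; rewrite e big_cons; ring.
  exists n.+1, (w * c); rewrite exprS -mulrA e big_cons [in LHS]xw; ring.
have [t [c [qt e]]] := loc q qP nqx.
have [//|[a' ea]] : divides q t \/ divides q a.
  apply: qM; rewrite e big_cons; exists (c * (u * \prod_(j <- s) j)); ring.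
have [|n [d ed]] := IH sP' a'.
  move=> p pP px; have [r [k [pr ek]]] := loc p pP px; exists r, k; split=> //.
  by apply: (mulIf q0); rewrite -mulrA -ea ek big_cons; ring.
by exists n, d; rewrite ea mulrA ed big_cons; ring.
Qed.

Lemma factor_of_prime_divides_prod (I : finType) (U : I -> R) (d : I -> nat) p :
  prime_elt p -> divides p (\prod_i U i ^+ d i) -> exists i, divides p (U i).
Proof.
move=> pP; rewrite -big_enum; elim: (enum I) => [|i s IH].
  by rewrite big_nil => /(prime_ndivides1 pP).
rewrite big_cons; have [_ _ pM] := pP; case/pM => [|//].
by move=> /(prime_dividesX pP); exists i.
Qed.

End Valuations.

(** * Normal forms and the two charts *)

Section PolyEval.
Variables (R : idomainType) (A : comNzRingType) (iota : {rmorphism R -> A}).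

Definition ev (x : A) (p : {poly R}) : A := (map_poly iota p).[x].

Lemma ev_is_zmod_morphism x : zmod_morphism (ev x).
Proof. by move=> p q; rewrite /ev rmorphB hornerD hornerN. Qed.

Lemma ev_is_monoid_morphism x : monoid_morphism (ev x).
Proof.
by split=> [|p q]; rewrite /ev ?rmorph1 ?hornerC // rmorphM hornerM.
Qed.

HB.instance Definition _ x :=
  GRing.isZmodMorphism.Build {poly R} A (ev x) (ev_is_zmod_morphism x).
HB.instance Definition _ x :=
  GRing.isMonoidMorphism.Build {poly R} A (ev x) (ev_is_monoid_morphism x).

Lemma evC x c : ev x c%:P = iota c.
Proof. by rewrite /ev map_polyC hornerC. Qed.

Lemma evX x : ev x 'X = x.
Proof. by rewrite /ev map_polyX hornerX. Qed.

Lemma evMXaddC x p c : ev x (p * 'X + c%:P) = ev x p * x + iota c.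
Proof. by rewrite rmorphD rmorphM /= evX evC. Qed.

Lemma poly_splitC (p : {poly R}) : exists q c, p = q * 'X + c%:P.
Proof.
elim/poly_ind: p => [|q c _]; last by exists q, c.
by exists 0, 0; rewrite mul0r addr0.
Qed.

Lemma polyMXaddC_eq0 (q : {poly R}) c : q * 'X + c%:P = 0 -> q = 0 /\ c = 0.
Proof.
move=> e; have c0 : c = 0.
  have := congr1 (fun p : {poly R} => p`_0) e.
  by rewrite coefD coefMX coefC !coef0 add0r.
split=> //; move: e; rewrite c0 addr0 => /eqP.
by rewrite mulf_eq0 polyX_eq0 orbF => /eqP.
Qed.

(* [A = R[x, y] / (xy - f)], through the normal form [p(x) + y q(y)]. *)
Definition xy_presentation (x y : A) (f : R) :=
  [/\ x * y = iota f,
      forall a, exists p q, a = ev x p + y * ev y q &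
      forall p q, ev x p + y * ev y q = 0 -> p = 0 /\ q = 0].

(** Only the constant term changes sides in the normal form. Each result on the chart of [x] thereby
    holds for that of [y]. *)
Lemma xy_presentation_sym x y f : xy_presentation x y f -> xy_presentation y x f.
Proof.
move=> [xyf gen free]; split; first by rewrite mulrC.
- move=> a; have [p [q ->]] := gen a; have [p1 [c ->]] := poly_splitC p.
  by exists (q * 'X + c%:P), p1; rewrite !evMXaddC; ring.
- move=> p q; have [p1 [c ->]] := poly_splitC p; rewrite evMXaddC => e.
  have [] := free (q * 'X + c%:P) p1; first by rewrite evMXaddC -e; ring.
  by move=> /polyMXaddC_eq0[-> ->] ->; rewrite mul0r addr0.
Qed.

End PolyEval.

Section Chart.
Variables (R : idomainType) (A : comNzRingType) (iota : {rmorphism R -> A}).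
Variables (f : R) (f0 : f != 0) (x y : A).
Hypothesis xyA : xy_presentation iota x y f.
Local Notation ev := (ev iota).
Implicit Types (p q : {poly R}) (a b c : A).

Lemma xy_mul : x * y = iota f. Proof. by case: xyA. Qed.

Lemma xy_free p q p' q' : ev x p + y * ev y q = ev x p' + y * ev y q' ->
  p = p' /\ q = q'.
Proof.
have [_ _ free] := xyA; move=> /eqP; rewrite -subr_eq0 => /eqP e.
have [] := free (p - p') (q - q'); first by rewrite !rmorphB -[RHS]e; ring.
by move=> /eqP; rewrite subr_eq0 => /eqP-> /eqP; rewrite subr_eq0 => /eqP->.
Qed.

Lemma ev_inj : injective (ev x).
Proof.
by move=> p p' e; have [] := @xy_free p 0 p' 0; rewrite ?rmorph0 ?mulr0 ?addr0.
Qed.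

Lemma ev_eq0 p : ev x p = 0 -> p = 0.
Proof. by move=> e; apply: ev_inj; rewrite e rmorph0. Qed.

Lemma mulx_normal p q (c : R) :
  x * (ev x p + y * ev y (q * 'X + c%:P)) =
  ev x (p * 'X + (f * c)%:P) + y * ev y (f%:P * q).
Proof.
rewrite !evMXaddC !rmorphM /= evC -xy_mul; ring.
Qed.

Lemma mulx_eq0 a : x * a = 0 -> a = 0.
Proof.
have [_ gen free] := xyA; have [p [q ->]] := gen a.
have [q1 [c ->]] := poly_splitC q; rewrite mulx_normal => /free[].
move=> /polyMXaddC_eq0[-> /eqP]; rewrite mulf_eq0 (negbTE f0) => /eqP->.
move=> /eqP; rewrite mulf_eq0 polyC_eq0 (negbTE f0) => /eqP->.
by rewrite mul0r addr0 !rmorph0 mulr0 addr0.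
Qed.

Lemma mulxn_inj n a b : x ^+ n * a = x ^+ n * b -> a = b.
Proof.
elim: n => [|n IH]; first by rewrite !mul1r.
rewrite !exprS -!mulrA => /eqP; rewrite -subr_eq0 -mulrBr => /eqP/mulx_eq0/eqP.
by rewrite subr_eq0 => /eqP.
Qed.

(** Each factor [y] is traded for [f] by one multiplication by [x]. *)
Lemma chart a : exists n p, x ^+ n * a = ev x p.
Proof.
have [_ gen _] := xyA; have [p [q ->]] := gen a.
suff [n [r e]] : exists n r, x ^+ n * (y * ev y q) = ev x r.
  by exists n, ('X^n * p + r); rewrite mulrDr e rmorphD rmorphM rmorphXn /= evX.
elim/poly_ind: q => [|q c [n [r e]]].
  by exists 0%N, 0; rewrite !rmorph0 !mulr0.
exists n.+1, (f%:P * r + 'X^n * (f * c)%:P).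
by rewrite evMXaddC rmorphD !rmorphM rmorphXn /= evX !evC -e -xy_mul exprS; ring.
Qed.

Lemma xy_domain a b : a * b = 0 -> a = 0 \/ b = 0.
Proof.
move=> ab; have [n [p ea]] := chart a; have [m [q eb]] := chart b.
have /ev_eq0/eqP : ev x (p * q) = 0.
  by rewrite rmorphM /= -ea -eb mulrACA ab mulr0.
rewrite mulf_eq0 => /orP[]/eqP z; [left | right].
  by apply: (@mulxn_inj n); rewrite ea z rmorph0 mulr0.
by apply: (@mulxn_inj m); rewrite eb z rmorph0 mulr0.
Qed.

Section ChartPrime.
Variables (t : {poly R}) (tP : prime_elt t) (tX : ~ divides t 'X).

(** The contraction to [A] of the prime ideal generated by [t] in R[x, 1/x]. *)
Definition chart_set : set A := [set a | exists n q, x ^+ n * a = ev x (q * t)].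

Lemma mem_chart n a p : x ^+ n * a = ev x p -> chart_set a <-> divides t p.
Proof.
move=> e; split=> [[m [q e']]|[q eq]]; last by exists n, q; rewrite -eq.
have [_ _ tM] := tP; have /tM[/(prime_dividesX tP)/tX //|//] : divides t ('X^m * p).
exists ('X^n * q); apply: ev_inj.
by rewrite -mulrA rmorphM [RHS]rmorphM /= !rmorphXn /= evX -e -e'; ring.
Qed.

Lemma mem_chart_ev p : chart_set (ev x p) <-> divides t p.
Proof. by apply: (@mem_chart 0); rewrite mul1r. Qed.

Lemma chart_ideal : is_ideal chart_set.
Proof.
split; first by exists 0%N, 0; rewrite mul0r rmorph0 mulr0.
- move=> a b [n [p ea]] [m [q eb]]; exists (n + m)%N, ('X^m * p + 'X^n * q).
  rewrite mulrDl -!mulrA rmorphD [in RHS]rmorphM [in X in _ = _ + X]rmorphM /=.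
  by rewrite -ea -eb !rmorphXn /= evX exprD; ring.
- move=> a b [m [q eb]]; have [n [p ea]] := chart a; exists (n + m)%N, (p * q).
  by rewrite -mulrA rmorphM /= -ea -eb exprD; ring.
Qed.

Lemma chart_proper : ~ chart_set 1.
Proof. by rewrite -(rmorph1 (ev x)) mem_chart_ev; exact: prime_ndivides1. Qed.

Lemma chart_primeM a b : chart_set (a * b) -> chart_set a \/ chart_set b.
Proof.
have [n [p ea]] := chart a; have [m [q eb]] := chart b.
rewrite (mem_chart ea) (mem_chart eb) (@mem_chart (n + m) _ (p * q)).
  by have [_ _ tM] := tP; exact: tM.
by rewrite rmorphM /= -ea -eb exprD; ring.
Qed.

Definition chart_prime : spec A := Spec chart_ideal chart_proper chart_primeM.

Lemma chart_notin : ~ chart_prime x.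
Proof. by rewrite /= -[in chart_set _](evX iota x) mem_chart_ev. Qed.

Lemma chart_dvr : prime_factorization {poly R} -> dvr_at chart_prime (ev x t).
Proof.
move=> fac; have t0 : t != 0 by case: tP.
split; first by apply/mem_chart_ev; exact: divides_refl.
  by move=> /ev_eq0/eqP; exact/negP.
move=> a a0; have [m [p e]] := chart a.
have p0 : p != 0.
  by apply/eqP => p0; apply: a0; apply: (@mulxn_inj m); rewrite e p0 rmorph0 mulr0.
have [n [q [eq nq]]] := prime_valuation fac tP p0.
exists n, (x ^+ m), (ev x q); split; first exact/notin_primeX/chart_notin.
  by rewrite /= mem_chart_ev.
by rewrite e eq rmorphM rmorphXn.
Qed.

End ChartPrime.

End Chart.
Section Chart2.
Variables (R : idomainType) (A : comNzRingType) (iota : {rmorphism R -> A}).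
Variables (f : R) (f0 : f != 0) (x y : A).
Hypothesis xyA : xy_presentation iota x y f.
Hypothesis facR : prime_factorization {poly R}.
Local Notation ev := (ev iota).
Implicit Types (p q t : {poly R}) (a b c : A) (P Q : spec A).

Let domA := xy_domain f0 xyA.

Lemma chart_height_one t (tP : prime_elt t) (tX : ~ divides t 'X) :
  height_one (chart_prime xyA tP tX).
Proof. exact/(dvr_height_one domA)/chart_dvr. Qed.

(** A nonzero element of [P] has a multiple by a power of [x] in R[x], and a prime factor [t] of it
    lies in [P]. The prime cut out by [t] has height one and is contained in [P], so the two
    coincide. *)
Lemma height_one_chart P : height_one P -> ~ P x ->
  exists t (tP : prime_elt t) (tX : ~ divides t 'X), P = chart_prime xyA tP tX.
Proof.
move=> hP Px; have [a Pa a0] := height_one_nonzero hP.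
have [n [p e]] := chart xyA a.
have p0 : p != 0.
  apply/eqP => p0; apply: a0; apply: (@mulxn_inj _ _ _ _ f0 _ _ xyA n).
  by rewrite e p0 rmorph0 mulr0.
have [u uU [s sP ep]] := facR p0.
have Pp : P (ev x p) by rewrite -e; exact: primeMl.
have [t ts Pt] : exists2 t, t \in s & P (ev x t).
  have /pset_prime[Pu|] : P (ev x u * ev x (\prod_(q <- s) q)) by rewrite -rmorphM -ep.
    have /pset_proper[] : P 1.
    rewrite -(rmorph1 (ev x)) -(mulVr uU) rmorphM; exact: primeMl.
  elim: (s) => [|q s' IH]; first by rewrite big_nil rmorph1 => /pset_proper.
  rewrite big_cons rmorphM => /pset_prime[Pq|/IH[t ts Pt]].
    by exists q; rewrite ?mem_head.
  by exists t; rewrite // inE ts orbT.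
have tX : ~ divides t 'X.
  by move=> [q eq]; apply: Px; rewrite -(evX iota x) eq rmorphM; exact: primeMl.
exists t, (sP t ts), tX; apply/esym/height_one_minimal => //.
  exact: chart_height_one.
move=> b [m [q eb]]; have : P (x ^+ m * b) by rewrite eb rmorphM; exact: primeMl.
by case/pset_prime => [/primeX|].
Qed.

(** Each prime [t] of R[X] not dividing ['X] gives a prime of height one of [A], at which the
    hypothesis applies. *)
Lemma chart_local a b : b <> 0 ->
    (forall P : prime_divisor A, exists s c, ~ P s /\ s * a = c * b) ->
  exists n c, x ^+ n * a = c * b.
Proof.
move=> b0 loc; have [i [p ea]] := chart xyA a; have [j [q eb]] := chart xyA b.
have q0 : q != 0.
  apply/eqP => q0; apply: b0; apply: (@mulxn_inj _ _ _ _ f0 _ _ xyA j).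
  by rewrite eb q0 rmorph0 mulr0.
have [|n [c e]] := @divides_of_local _ 'X p q facR q0; last first.
  exists (n + i)%N, (ev x c * x ^+ j).
  by rewrite exprD -mulrA ea -mulrA eb -rmorphM -e rmorphM rmorphXn /= evX.
move=> t tP tX.
have [s [c [Ps e]]] := loc (PrimeDivisor (chart_height_one tP tX)).
have [k [s' es]] := chart xyA s; have [l [c' ec]] := chart xyA c.
have nts : ~ divides t s' by move=> /(mem_chart xyA tP tX es).
exists ('X^(j + l) * s'), ('X^(k + i) * c'); split.
  have [_ _ tM] := tP; case/tM => // /(prime_dividesX tP); exact: tX.
apply: (ev_inj xyA).
rewrite !rmorphM !rmorphXn /= !evX -ea -eb -es -ec !exprD.
transitivity (x ^+ j * x ^+ l * x ^+ k * x ^+ i * (s * a)); first by ring.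
by rewrite e; ring.
Qed.

(** [y] is not a zero divisor modulo [x]: comparing normal forms shows that the part p(y) of [b] is
    divisible by f, which is xy. *)
Lemma xy_regular a b : x * a = y * b -> exists c, b = x * c.
Proof.
have yxA := xy_presentation_sym xyA; have [_ gen _] := yxA.
have [p [q ->]] := gen b; have [r [s ->]] := gen a.
have [q1 [c ->]] := poly_splitC q; have [r1 [e ->]] := poly_splitC r => h.
have [] := @xy_free _ _ _ _ _ _ yxA (f%:P * r1) (e%:P + 'X * s)
    (p * 'X + (f * c)%:P) (f%:P * q1).
  rewrite -(mulx_normal yxA) -h evMXaddC !rmorphD !rmorphM /= !evC evX.
  by rewrite -(xy_mul xyA); ring.
move=> e1 _; have [t et] : exists t, p = f%:P * t.
  have [t [d ed]] := poly_splitC (r1 - c%:P); exists t.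
  have : (f%:P * t - p) * 'X + (f * d)%:P = 0.
    transitivity (f%:P * (t * 'X + d%:P) - p * 'X); first by rewrite polyCM; ring.
    by rewrite -ed mulrBr e1 polyCM; ring.
  by move=> /polyMXaddC_eq0[/eqP]; rewrite subr_eq0 => /eqP.
exists (y * ev y t + ev x (q1 * 'X + c%:P)).
by rewrite et rmorphM /= evC -(xy_mul xyA); ring.
Qed.

Lemma xy_regularX m n a b : x ^+ n * a = y ^+ m * b -> exists c, b = x ^+ n * c.
Proof.
have reg1 k c d : x ^+ k * c = y * d -> exists e, d = x ^+ k * e.
  elim: k d => [|k IH] d; first by exists d; rewrite mul1r.
  rewrite exprS -mulrA => h; have [e ed] := xy_regular h.
  have [|e' ee'] := IH e.
    apply: (@mulxn_inj _ _ _ _ f0 _ _ xyA 1); rewrite expr1 h ed; ring.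
  by exists e'; rewrite ed ee' mulrA.
elim: m a b => [|m IH] a b; first by rewrite mul1r => <-; exists a.
rewrite exprS -mulrA => /reg1[c e]; have [d ->] := IH c b (esym e); by exists d.
Qed.

End Chart2.

(** * Primes of height one of the ring *)

Section XYDivisors.
Variables (R : idomainType) (A : comNzRingType) (iota : {rmorphism R -> A}).
Variables (f : R) (f0 : f != 0) (x y : A).
Hypothesis xyA : xy_presentation iota x y f.
Hypothesis facR : prime_factorization R.
Local Notation ev := (ev iota).
Implicit Types (p q t : {poly R}) (a b c : A) (P Q : spec A).

Let domA := xy_domain f0 xyA.
Let yxA := xy_presentation_sym xyA.
Let facX := gauss_prime_factorization facR.

(** The two charts show that [b] divides x^n a and y^m a, so that a / b is regular on D(x) and on
    D(y); [xy_regularX] removes the denominators. *)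
Lemma xy_dvd_of_local a b : b <> 0 ->
    (forall P : prime_divisor A, exists s c, ~ P s /\ s * a = c * b) ->
  exists c, a = c * b.
Proof.
move=> b0 loc; have [n [c ec]] := chart_local f0 xyA facX b0 loc.
have [m [d ed]] := chart_local f0 yxA facX b0 loc.
have [|e ee] := @xy_regularX _ _ _ _ f0 _ _ xyA m n d c.
  apply: (domain_lreg domA b0).
  transitivity (x ^+ n * (d * b)); first by ring.
  by rewrite -ed; transitivity (y ^+ m * (c * b)); [rewrite -ec; ring | ring].
exists e; apply: (@mulxn_inj _ _ _ _ f0 _ _ xyA n).
by rewrite ec ee mulrA.
Qed.

Lemma polyC_ndividesX (u : R) : prime_elt u -> ~ divides u%:P 'X.
Proof.
move=> uP /divides_polyC/(_ 1%N); rewrite coefX eqxx.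
exact: prime_ndivides1.
Qed.

(** The prime on the left is the ideal (x, u): in the chart of [y] the element x = f / y is a
    multiple of [u], so for p(y) + x r(x) in this prime [u] divides [p]. *)
Lemma chart_prime_sub (u : R) (uP : prime_elt u%:P) (uX : ~ divides u%:P 'X) P :
  divides u f -> P x -> P (iota u) -> pset (chart_prime yxA uP uX) `<=` pset P.
Proof.
move=> uf Px Pu a [n [q e]].
have [p [r ea]] : exists p r, a = ev y p + x * ev x r.
  by have [_ gen _] := yxA; exact: gen.
have [m [r' er]] := chart yxA (ev x r).
have [w ew] : divides u%:P p.
  have [_ _ uM] := uP.
  have /uM[/(prime_dividesX uP)/uX //|//] :
      divides u%:P ('X^(n + m.+1) * p).
    have -> : 'X^(n + m.+1) * p = 'X^(m.+1) * (q * u%:P) - 'X^n * f%:P * r'.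
      apply: (ev_inj yxA).
      rewrite rmorphB [in RHS]rmorphM /= -e !rmorphM !rmorphXn /= evX evC.
      by rewrite -er ea -(xy_mul xyA) !exprD !exprS; ring.
    apply: dividesB; first by do 2!apply: divides_mull; exact: divides_refl.
    apply/divides_mulr/divides_mull; have [h ->] := uf; exists h%:P.
    by rewrite polyCM.
rewrite ea ew rmorphM /= evC; apply: primeD; first exact: primeMl.
exact: primeMr.
Qed.

(** A prime containing [x] and [y] contains [f], hence a prime factor [u] of it, and so the prime
    (x, u) of height one, which misses [y]. *)
Lemma height_one_notin_xy P : height_one P -> P x -> ~ P y.
Proof.
move=> hP Px Py; have [v vU [s sP ef]] := facR f0.
have Pf : P (iota f) by rewrite -(xy_mul xyA); exact: primeMl.
have [u [us Pu]] : exists u, u \in s /\ P (iota u).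
  have /pset_prime[Pv|] : P (iota v * iota (\prod_(q <- s) q)) by rewrite -rmorphM -ef.
    have /pset_proper[] : P 1.
    by rewrite -(rmorph1 iota) -(mulVr vU) rmorphM; exact: primeMl.
  elim: (s) => [|q s' IH]; first by rewrite big_nil rmorph1 => /pset_proper.
  rewrite big_cons rmorphM => /pset_prime[Pq|/IH[u [us Pu]]].
    by exists q; rewrite ?mem_head.
  by exists u; rewrite // inE us orbT.
have uP := sP u us; have uX := polyC_ndividesX uP.
have uf : divides u f.
  by rewrite ef (big_rem u us) /=; apply/divides_mull/divides_mulr/divides_refl.
have hc := chart_height_one f0 yxA facX (prime_polyC uP) uX.
have := @chart_notin _ _ _ _ _ _ yxA _ (prime_polyC uP) uX.
by rewrite (height_one_minimal hc hP) //; exact: chart_prime_sub.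
Qed.

Lemma xy_dvr (P : prime_divisor A) : exists t : A, dvr_at P t.
Proof.
have hP := pd_height_one P; have [Px|Px] := pselect (P x).
  have [t [tP [tX ->]]] := height_one_chart f0 yxA facX hP (height_one_notin_xy hP Px).
  by exists (ev y t); exact: chart_dvr.
have [t [tP [tX ->]]] := height_one_chart f0 xyA facX hP Px.
by exists (ev x t); exact: chart_dvr.
Qed.

End XYDivisors.

(* Writing the partition of unity on an affine [D(x) U D(w)] as fractions at
   the generic point. *)
Lemma affine_cover_fractions (A : comNzRingType)
    (domA : forall a b : A, a * b = 0 -> a = 0 \/ b = 0)
    (W : set (spec A)) (x w : A) : x <> 0 -> w <> 0 -> affine_open W ->
    (forall P, W P <-> ~ P x \/ ~ P w) ->
  exists a b c m n k, w ^+ m.+1 * a = x ^+ n.+1 * b /\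
    x ^+ n.+1 * x ^+ k.+1 = x ^+ k.+1 * a * x + x ^+ n.+1 * c * w.
Proof.
move=> x0 w0 affW Wxw.
have [alpha [beta e]] : exists a b : sections W, a * sec_cst W x + b * sec_cst W w = 1.
  by apply: affine_cover_unit => // P /Wxw.
have Wx (P : spec A) : ~ P x -> W P by move=> Px; apply/Wxw; left.
have Ww (P : spec A) : ~ P w -> W P by move=> Pw; apply/Wxw; right.
have [a [n an]] := sections_fraction alpha Wx.
have [b [m bm]] := sections_fraction alpha Ww.
have [c [k ck]] := sections_fraction beta Wx.
have [Z Z0] := exists_zero_prime domA.
have notinZ z : z <> 0 -> ~ Z z by move=> z0 /Z0.
have WZ : W Z := Wx Z (notinZ x x0).
have injZ z z' : to_loc (prime_compl Z) z = to_loc (prime_compl Z) z' -> z = z'.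
  move=> /to_loc_eqP[v Zv]; apply: (domain_lreg domA).
  exact: notin_prime_neq0 Zv.
have ea := fraction_onP WZ an (notin_primeX (notinZ x x0)).
have eb := fraction_onP WZ bm (notin_primeX (notinZ w w0)).
have ec := fraction_onP WZ ck (notin_primeX (notinZ x x0)).
have e1 := congr1 (fun s : sections W => s Z WZ) e.
exists a, b, c, m, n, k; split; apply: injZ.
  by rewrite !rmorphM /= -ea -eb; ring.
rewrite rmorphM rmorphD !rmorphM /= -ea -ec -[LHS]mulr1.
transitivity (to_loc (prime_compl Z) (x ^+ n.+1) * to_loc (prime_compl Z) (x ^+ k.+1) *
  (alpha Z WZ * to_loc (prime_compl Z) x + beta Z WZ * to_loc (prime_compl Z) w)).
  by congr (_ * _); rewrite -[LHS]e1.
ring.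
Qed.

(** * Open sets that are not affine *)

Section NotAffine.
Variables (R : idomainType) (A : comNzRingType) (iota : {rmorphism R -> A}).
Variables (f : R) (f0 : f != 0) (x y : A).
Hypothesis xyA : xy_presentation iota x y f.
Hypothesis facR : prime_factorization R.
Hypothesis locR : local_ring R.
Local Notation ev := (ev iota).

(* For the prime [u], which divides [f] but not [w], a section [a / x ^+ n.+1]
   has [u | a_n], because [w ^+ m.+1 a] is a multiple of [x ^+ n.+1]; so
   [1 = alpha x + beta w] puts [1] in the ideal [(u, w)] of [R]. *)
Lemma punctured_not_affine (u w : R) (W : set (spec A)) :
    prime_elt u -> divides u f -> ~ divides u w -> (forall z : R, z * w <> 1) ->
    (forall P, W P <-> ~ P x \/ ~ P (iota w)) ->
  ~ affine_open W.
Proof.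
move=> uP uf uw nw Wxw affW.
have domA := xy_domain f0 xyA.
have x0 : x <> 0.
  move=> x0; have := @mulx_eq0 _ _ _ _ f0 _ _ xyA 1; rewrite x0 mul0r => /(_ erefl).
  by apply/eqP; exact: oner_neq0.
have w0 : iota w <> 0.
  rewrite -(evC iota x) => /(ev_eq0 xyA)/eqP; rewrite polyC_eq0 => /eqP w0.
  by apply: uw; rewrite w0; exact: divides0.
have [a [b [c [m [n [k [e1 e2]]]]]]] := affine_cover_fractions domA x0 w0 affW Wxw.
have [i [p ea]] := chart xyA a; have [j [q ec]] := chart xyA c.
have [b1 [b2 eb]] : exists b1 b2, b = ev x b1 + y * ev y b2.
  by have [_ gen _] := xyA; exact: gen.
have [l [s es]] := chart xyA (ev y b2).
have {}e1 : 'X^l * (w%:P ^+ m.+1 * p) = 'X^i * ('X^(l + n.+1) * b1 + f%:P * ('X^n * s)).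
  apply: (ev_inj xyA); rewrite !(rmorphM, rmorphD) /= !rmorphXn /= !evX !evC -ea -es.
  transitivity (x ^+ l * x ^+ i * (iota w ^+ m.+1 * a)); first by ring.
  by rewrite e1 eb -(xy_mul xyA) !exprD !exprS; ring.
have {}e2 : 'X^(n.+1 + k.+1 + i + j) =
    'X^(k.+1 + j) * ('X * p) + 'X^(n.+1 + i) * (q * w%:P).
  apply: (ev_inj xyA); rewrite !(rmorphM, rmorphD) /= !rmorphXn /= !evX !evC -ea -ec.
  transitivity (x ^+ i * x ^+ j * (x ^+ n.+1 * x ^+ k.+1)).
    by rewrite !exprD; ring.
  by rewrite e2 !exprD !exprS; ring.
have [_ _ uM] := uP.
(* In degree [l + (i + n)] the term with [b1], which starts one degree higher, does not contribute;
   what remains is a multiple of [f]. *)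
have up : divides u p`_(i + n).
  have /uM[/(prime_dividesX uP)/uw //|//] : divides u (w ^+ m.+1 * p`_(i + n)).
  have := congr1 (fun g : {poly R} => g`_(l + (i + n))) e1.
  rewrite coefXnM ltnNge leq_addr /= addKn -rmorphXn coefCM => ->.
  rewrite addnCA coefXnM ltnNge leq_addr /= addKn.
  rewrite coefD coefXnM ltn_add2l ltnSn add0r coefCM.
  exact: divides_mulr.
(* The left side is a single monomial; its coefficient 1 becomes the sum of the coefficient of [p]
   just treated and a multiple of [w]. *)
have := congr1 (fun g : {poly R} => g`_(n.+1 + k.+1 + i + j)) e2.
rewrite coefXn eqxx coefD !coefXnM !ifF; [|lia|lia].
have -> : (n.+1 + k.+1 + i + j - (k.+1 + j) = (i + n).+1)%N by lia.
rewrite coefXM coefMC /=; have [v ->] := up => /esym.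
apply: (local_nonunit_comb locR) nw.
by move=> z zu; apply: (prime_ndivides1 uP); exists z.
Qed.

End NotAffine.

(** * Normal form in the quotient ring *)

Section XYPresentation.
Variables (R : idomainType) (f : R).

Definition xy_pi : {poly {poly R}} -> xy_ring f := \pi_(Quotient.quot (xy_ideal f)).

Lemma xy_pi_is_zmod_morphism : zmod_morphism xy_pi.
Proof. by move=> p q; rewrite /xy_pi rmorphB. Qed.

Lemma xy_pi_is_monoid_morphism : monoid_morphism xy_pi.
Proof. by split=> [|p q]; rewrite /xy_pi ?rmorph1 ?rmorphM. Qed.

HB.instance Definition _ := GRing.isZmodMorphism.Build
  {poly {poly R}} (xy_ring f) xy_pi xy_pi_is_zmod_morphism.
HB.instance Definition _ := GRing.isMonoidMorphism.Build
  {poly {poly R}} (xy_ring f) xy_pi xy_pi_is_monoid_morphism.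

Definition xy_cst (c : R) : xy_ring f := xy_pi c%:P%:P.

Lemma xy_cst_is_zmod_morphism : zmod_morphism xy_cst.
Proof. by move=> a b; rewrite /xy_cst !rmorphB. Qed.

Lemma xy_cst_is_monoid_morphism : monoid_morphism xy_cst.
Proof. by split=> [|a b]; rewrite /xy_cst ?rmorph1 ?rmorphM. Qed.

HB.instance Definition _ := GRing.isZmodMorphism.Build
  R (xy_ring f) xy_cst xy_cst_is_zmod_morphism.
HB.instance Definition _ := GRing.isMonoidMorphism.Build
  R (xy_ring f) xy_cst xy_cst_is_monoid_morphism.

Lemma xy_pi_eq0 p : xy_pi p = 0 -> exists q, p = q * xy_poly f.
Proof.
move=> e; suff : p \in xy_ideal f by move=> /asboolP.
rewrite -[p]subr0 Quotient.idealrBE; apply/eqP.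
by rewrite -[LHS]/(xy_pi p) e -(rmorph0 xy_pi).
Qed.

Lemma xy_pi_poly : xy_pi (xy_poly f) = 0.
Proof.
rewrite -(rmorph0 xy_pi); apply/eqP.
rewrite -[X in is_true X]/(xy_poly f == 0 %[mod Quotient.quot (xy_ideal f)]).
rewrite -Quotient.idealrBE subr0; apply/asboolP.
by exists 1; rewrite mul1r.
Qed.

Lemma xy_ring_presentation :
  xy_presentation (xy_cst : {rmorphism R -> xy_ring f}) (xy_pi 'X%:P) (xy_pi 'X) f.
Proof.
have evx p : ev xy_cst (xy_pi 'X%:P) p = xy_pi p%:P.
  elim/poly_ind: p => [|p c IH]; first by rewrite !rmorph0.
  by rewrite evMXaddC IH polyCD polyCM rmorphD rmorphM.
have evy p : ev xy_cst (xy_pi 'X) p = xy_pi (map_poly polyC p).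
  elim/poly_ind: p => [|p c IH]; first by rewrite !rmorph0.
  rewrite evMXaddC IH !rmorphD !rmorphM /= map_polyX map_polyC.
  by [].
have mulxy : xy_pi 'X%:P * xy_pi 'X = xy_cst f.
  apply/eqP; rewrite -subr_eq0 -rmorphM -rmorphB; apply/eqP; exact: xy_pi_poly.
split=> //.
- move=> a; have [P ->] : exists P, a = xy_pi P.
    by exists (repr a); rewrite /xy_pi reprK.
  elim/poly_ind: P => [|P c [p [q IH]]].
    by exists 0, 0; rewrite !rmorph0 mulr0 addr0.
  have [p1 [e ep]] := poly_splitC p; rewrite ep evMXaddC in IH.
  exists (f%:P * p1 + c), (q * 'X + e%:P).
  rewrite [LHS]rmorphD rmorphM /= IH -(evx c) evMXaddC rmorphD rmorphM /= evC /= -mulxy.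
  ring.
- move=> p q; rewrite evx evy -rmorphM -rmorphD => /xy_pi_eq0[g eg].
  have g0 : g = 0.
    apply/eqP; apply: contrapT => /negP g0.
    (* In this degree in Y the multiple of XY - f has the coefficient [lead_coef g * 'X], while the
       normal form has a constant of [R]; so both vanish. *)
    have := congr1 (fun h : {poly {poly R}} => h`_(size g)) eg.
    have sg : (0 < size g)%N by rewrite size_poly_gt0.
    rewrite coefD coefC (gtn_eqF sg) add0r coefXM (gtn_eqF sg) coef_map_id0 ?polyC0 //.
    rewrite /xy_poly mulrBr coefB mulrA coefMX (gtn_eqF sg) !coefMC -/(lead_coef g).
    rewrite [g`_(size g)]nth_default // mul0r subr0 => e.
    have : lead_coef g * 'X + (- q`_(size g).-1)%:P = 0 by rewrite polyCN -e subrr.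
    by move=> /polyMXaddC_eq0[/eqP]; rewrite lead_coef_eq0 (negbTE g0).
  rewrite g0 mul0r in eg.
  have coefE i := congr1 (fun h : {poly {poly R}} => h`_i) eg.
  split.
    by have := coefE 0%N; rewrite coefD coefC eqxx coefXM eqxx addr0 coef0.
  apply/polyP => i; have := coefE i.+1.
  rewrite coefD coefC add0r coefXM /= coef_map_id0 ?polyC0 // !coef0.
  by move=> /eqP; rewrite polyC_eq0 => /eqP.
Qed.

End XYPresentation.

(** * The components of the divisor of x *)

Section Components.
Variables (R : idomainType) (A : comNzRingType) (iota : {rmorphism R -> A}).
Variables (x y : A) (r : nat) (U : 'I_r -> R) (d : 'I_r -> nat).
Local Notation f := (\prod_(i < r) U i ^+ d i).
Hypothesis hU : forall i, prime_elt (U i).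
Hypothesis hassoc : forall i j, i <> j -> ~ associated (U i) (U j).
Hypothesis hd : forall i, (0 < d i)%N.
Hypothesis xyA : xy_presentation iota x y f.
Hypothesis facR : prime_factorization R.
Hypothesis locR : local_ring R.
Local Notation ev := (ev iota).
Implicit Types (a b c : 'I_r -> int) (P Q : spec A) (D E : Div A).

Let yxA := xy_presentation_sym xyA.
Let facX := gauss_prime_factorization facR.

Let f0 : f != 0.
Proof. by apply/prodf_neq0 => i _; rewrite expf_neq0 //; case: (hU i). Qed.

Let domA := xy_domain f0 xyA.

Let U_dvd_f i : divides (U i) f.
Proof.
rewrite (bigD1 i) //=; apply: divides_mulr; rewrite -(prednK (hd i)) exprS.
exact/divides_mulr/divides_refl.
Qed.

(** The prime (x, U_i). It contains [x], so it is defined in the chart of [y]. *)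
Definition component i : prime_divisor A := PrimeDivisor
  (chart_height_one f0 yxA facX (prime_polyC (hU i)) (@polyC_ndividesX _ _ (hU i))).

Lemma component_x i : component i x.
Proof.
have e : y ^+ 1 * x = ev y f%:P by rewrite evC -(xy_mul xyA) mulrC.
apply/(mem_chart yxA (prime_polyC (hU i)) (@polyC_ndividesX _ _ (hU i)) e).
by have [c ->] := U_dvd_f i; exists c%:P; rewrite polyCM.
Qed.

Lemma component_y i : ~ component i y.
Proof. exact: chart_notin. Qed.

Lemma component_U i j : component i (iota (U j)) <-> i = j.
Proof.
rewrite -(evC iota y).
apply: (iff_trans (mem_chart_ev yxA (prime_polyC (hU i))
  (@polyC_ndividesX _ _ (hU i)) _)).
split=> [/divides_polyC/(_ 0%N)|->]; last exact: divides_refl.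
rewrite coefC eqxx => /(prime_divides_associated (hU i) (hU j)) asc.
by apply: contrapT => /hassoc.
Qed.

Lemma component_inj : injective component.
Proof. by move=> i j ij; apply/component_U; rewrite ij; exact/component_U. Qed.

(** Such a [P] is cut out by a prime [t] in the chart of [y], where x = f / y; so [t] divides [f]
    and hence some [U i]. *)
Lemma component_cover (P : prime_divisor A) : P x -> exists i, component i = P.
Proof.
move=> Px; have hP := pd_height_one P.
have [t [tP [tX eP]]] := height_one_chart f0 yxA facX hP
  (height_one_notin_xy f0 xyA facR hP Px).
have e : y ^+ 1 * x = ev y f%:P by rewrite evC -(xy_mul xyA) mulrC.
have : divides t (\prod_(i < r) (U i)%:P ^+ d i).
  have -> : \prod_(i < r) (U i)%:P ^+ d i = f%:P.
    by rewrite rmorph_prod; apply: eq_bigr => i _; rewrite rmorphXn.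
  by apply/(mem_chart yxA tP tX e); rewrite eP in Px.
move=> /(factor_of_prime_divides_prod tP)[i [w ew]]; exists i.
apply: prime_divisor_eq; rewrite eP => z [n [q eq]]; exists n, (q * w).
by rewrite eq ew mulrA.
Qed.

Lemma component_dvr i : dvr_at (component i) (iota (U i)).
Proof.
by rewrite -(evC iota y); apply: (chart_dvr f0 yxA).
Qed.

Lemma order_of_x i : order_of (component i) (iota (U i)) x (d i).
Proof.
exists y, (iota (\prod_(j < r | j != i) U j ^+ d j)); split; first exact: component_y.
  rewrite rmorph_prod; elim/big_ind: _ => [|u v|j ji]; first exact: pset_proper.
    exact: notin_primeM.
  rewrite rmorphXn; apply: notin_primeX => /component_U ij.
  by rewrite ij eqxx in ji.
by rewrite mulrC (xy_mul xyA) (bigD1 i) //= rmorphM rmorphXn.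
Qed.

Definition comb a : Div A := \sum_(i < r) << a i *g component i >>.

Lemma coeff_comb (P : prime_divisor A) a :
  coeff P (comb a) = \sum_(i < r) a i * (component i == P)%:R.
Proof.
rewrite /comb raddf_sum /=; apply: eq_bigr => i _.
by rewrite coeffU eq_sym.
Qed.

Lemma coeff_comb_component i a : coeff (component i) (comb a) = a i.
Proof.
rewrite coeff_comb (bigD1 i) //= eqxx mulr1 big1 ?addr0 // => j ji.
by rewrite (inj_eq component_inj) (negbTE ji) mulr0.
Qed.

Lemma coeff_comb_out (P : prime_divisor A) a : ~ P x -> coeff P (comb a) = 0.
Proof.
move=> Px; rewrite coeff_comb big1 // => i _.
suff /negbTE -> : component i != P by rewrite mulr0.
by apply/eqP => eP; apply: Px; rewrite -eP; exact: component_x.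
Qed.

Lemma comb_eqP D a : (forall i, coeff (component i) D = a i) ->
  (forall P : prime_divisor A, ~ P x -> coeff P D = 0) -> D = comb a.
Proof.
move=> Da D0; apply/eqP/freeg_eqP => P /=.
have [/component_cover[i <-]|Px] := pselect (P x).
  by rewrite coeff_comb_component.
by rewrite coeff_comb_out // D0.
Qed.

Lemma combB a b : comb a - comb b = comb (fun i => a i - b i).
Proof.
apply: comb_eqP => [i|P Px]; rewrite coeffB; first by rewrite !coeff_comb_component.
by rewrite !coeff_comb_out // subr0.
Qed.

Lemma combMz a n : comb a *~ n = comb (fun i => a i * n).
Proof.
apply: comb_eqP => [i|P Px]; rewrite raddfMz /=.
  by rewrite coeff_comb_component -mulrzr intz.
by rewrite coeff_comb_out // mul0rz.
Qed.

(** This is the divisor of [x]. *)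
Lemma principal_comb_d : principal (comb (fun i => (d i)%:Z)).
Proof.
apply: (principal_of_orders domA (a := x)).
  move=> x0; have := @mulx_eq0 _ _ _ _ f0 _ _ xyA 1; rewrite x0 mul0r => /(_ erefl).
  by apply/eqP; exact: oner_neq0.
move=> P; have [/component_cover[i <-]|Px] := pselect (P x).
  exists (iota (U i)); first exact: component_dvr.
  by exists (d i); [exact: order_of_x | rewrite coeff_comb_component].
have [t dP] := xy_dvr f0 xyA facR P; exists t => //.
by exists 0%N; [exact: order_of0 | rewrite coeff_comb_out].
Qed.

(** If [P] avoids [x], it is cut out on D(x) by a prime polynomial [t], and the divisor of t(x) is
    [P] plus a combination of components. *)
Lemma prime_divisor_equiv_comb (P : prime_divisor A) :
  exists a, principal (<< P >> - comb a).
Proof.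
have [/component_cover[i <-]|Px] := pselect (P x).
  exists (fun j => (j == i)%:R).
  suff -> : << component i >> = comb (fun j => (j == i)%:R).
    by rewrite subrr; exact: principal0.
  apply: comb_eqP => [j|P' P'x]; rewrite coeffU mul1r.
    by rewrite (inj_eq component_inj) eq_sym.
  by case: eqP => // eP; case: P'x; rewrite -eP; exact: component_x.
have hP := pd_height_one P.
have [t [tP [tX eP]]] := height_one_chart f0 xyA facX hP Px.
have dP := chart_dvr f0 xyA tP tX facX; rewrite -eP in dP.
have [Pt t0 _] := dP.
have /choice[m mP] i : exists m, order_of (component i) (iota (U i)) (ev x t) m.
  by have [_ _] := component_dvr i; exact.
exists (fun i => - (m i)%:Z); apply: (principal_of_orders domA t0) => P'.
have [/component_cover[i <-]|P'x] := pselect (P' x).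
  exists (iota (U i)); first exact: component_dvr.
  exists (m i) => //; rewrite coeffB coeff_comb_component opprK coeffU mul1r.
  case: eqP => [eP'|_]; last by rewrite add0r.
  by case: Px; rewrite eP'; exact: component_x.
have [t' dP'] := xy_dvr f0 xyA facR P'.
rewrite coeffB coeff_comb_out // subr0 coeffU mul1r.
have [eP'|nP] := eqVneq P P'.
  by rewrite -eP'; exists (ev x t) => //; exists 1%N => //; exact: order_of_gen.
exists t' => //; exists 0%N => //; apply: order_of0 => P't.
case/eqP: nP; apply: prime_divisor_eq; rewrite eP => z [n [q eq]].
have : P' (x ^+ n * z) by rewrite eq rmorphM; exact: primeMl.
by case/pset_prime => [/primeX|].
Qed.

Lemma divisor_equiv_comb D : exists a, principal (D - comb a).
Proof.
rewrite -[D]freeg_sumE; elim/big_ind: _ => [|D1 D2 [a pa] [b pb]|P _].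
- exists (fun=> 0); suff -> : comb (fun=> 0) = 0 by rewrite subr0; exact: principal0.
  by rewrite /comb big1 // => i _; rewrite freegU0.
- exists (fun i => a i - - b i); rewrite -combB.
  have -> : D1 + D2 - (comb a - comb (fun i => - b i)) = (D1 - comb a) + (D2 - comb b).
    have -> : comb (fun i => - b i) = - comb b.
      apply/esym/comb_eqP => [i|P Px]; rewrite coeffN.
        by rewrite coeff_comb_component.
      by rewrite coeff_comb_out ?oppr0.
    by rewrite opprK opprD addrACA.
  exact: principalD.
- have [a pa] := prime_divisor_equiv_comb P; set k := coeff P D.
  exists (fun i => a i * k); rewrite -combMz.
  have -> : << k *g P >> = << P >> *~ k by rewrite freegU_mulz intz.
  by rewrite -mulrzBl; exact: principalMz.
Qed.

Lemma supp_compl_comb a P :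
  supp_compl (comb a) P <-> ~ P x \/ ~ P (iota (\prod_(i < r | a i != 0) U i)).
Proof.
split=> [nP|xw [Q Q0 QP]].
  apply/not_andP => -[Px]; rewrite rmorph_prod /=.
  have mem_prod : P (\prod_(i < r | a i != 0) iota (U i)) ->
      exists i, a i != 0 /\ P (iota (U i)).
    elim/big_ind: _ => [/pset_proper //|u v IHu IHv /pset_prime[/IHu|/IHv] //|i ai Pi].
    by exists i.
  move=> /mem_prod[i [ai Pi]]; apply: nP; exists (component i).
    by rewrite coeff_comb_component.
  exact: (chart_prime_sub (U_dvd_f i) Px Pi).
have [Qx|Qx] := pselect (Q x); last by move: Q0; rewrite coeff_comb_out ?eqxx.
have [i eQ] := component_cover Qx.
move: Q0; rewrite -eQ coeff_comb_component => ai.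
case: xw; apply; apply: QP; first exact: Qx.
rewrite rmorph_prod (bigD1 i) //=; apply: primeMr; rewrite -eQ.
exact/component_U.
Qed.

(** [punctured_not_affine] with u = U_i and [w] the product of the [U k] with [a k] nonzero: [U i]
    does not divide [w] since [a i = 0], and [w] is not a unit since [U j] divides it. *)
Lemma comb_not_coaffine a i j :
  a i = 0 -> a j <> 0 -> ~ affine_open (supp_compl (comb a)).
Proof.
move=> ai aj; apply: (punctured_not_affine f0 xyA locR (hU i) (U_dvd_f i)); last first.
- exact: supp_compl_comb.
- move=> z e; apply: (prime_ndivides1 (hU j)); rewrite -e (bigD1 j) /=; last exact/eqP.
  exact/divides_mull/divides_mulr/divides_refl.
- have nd (s : seq 'I_r) : (forall k, k \in s -> k <> i) ->
      ~ divides (U i) (\prod_(k <- s) U k).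
    elim: s => [|k s IH] ns; first by rewrite big_nil; exact: prime_ndivides1.
    rewrite big_cons; have [_ _ uM] := hU i.
    case/uM => [/(prime_divides_associated (hU i) (hU k))|].
      by apply: hassoc => ik; apply: (ns k); rewrite ?mem_head.
    by apply: IH => l ls; apply: ns; rewrite inE ls orbT.
  rewrite -big_filter; apply: nd => k; rewrite mem_filter => /andP[ak _] ki.
  by move: ak; rewrite ki ai eqxx.
Qed.

(** At an index where a_i / d_i is least, subtracting a_i div x from d_i times the combination
    leaves nonnegative coefficients, with 0 at [i]. *)
Lemma exists_min_ratio (i0 : 'I_r) a :
  exists i, forall j, a i * (d j)%:Z <= a j * (d i)%:Z.
Proof.
pose g i : rat := (a i)%:~R / (d i)%:R.
exists [arg min_(i < i0) g i]%O; case: arg_minP => // i _ imin j.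
have dp k : 0 < (d k)%:R :> rat by rewrite ltr0n.
have := imin j isT; rewrite /g ler_pdivrMr // mulrAC ler_pdivlMr //.
by rewrite -[(d i)%:R]/((d i)%:Z%:~R) -[(d j)%:R]/((d j)%:Z%:~R) -!intrM ler_int.
Qed.

Theorem strongly_coaffine_torsion D :
  strongly_coaffine D -> exists2 n : int, n <> 0 & principal (D *~ n).
Proof.
move=> sD; have [a Da] := divisor_equiv_comb D.
(* Without components, that is for r = 0, every divisor is principal. *)
have [[i0 _]|no_i] := pselect (exists i0 : 'I_r, True); last first.
  exists 1 => //; rewrite mulr1z; suff ca : comb a = 0 by rewrite ca subr0 in Da.
  by rewrite /comb big1 // => i; case: no_i; exists i.
have [i imin] := exists_min_ratio i0 a.
exists (d i)%:Z; first by have := hd i; lia.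
have [cD|//] := sD (d i)%:Z.
pose e j := a j * (d i)%:Z - (d j)%:Z * a i.
have De : principal (comb e - D *~ (d i)%:Z).
  have -> : comb e = comb a *~ (d i)%:Z - comb (fun j => (d j)%:Z) *~ a i.
    by rewrite !combMz combB.
  rewrite addrAC -mulrzBl; apply: principalB; apply: principalMz.
    by rewrite -opprB; exact: principalN.
  exact: principal_comb_d.
have effe : effective (comb e).
  move=> P; have [/component_cover[j <-]|Px] := pselect (P x);
    last by rewrite coeff_comb_out.
  by rewrite coeff_comb_component /e subr_ge0 mulrC.
have affe := cD _ effe De.
(* The coefficient of [e] at [i] is 0 by construction, so a nonzero coefficient at some [j] would
   contradict affineness. *)
have [[j ej]|e0] := pselect (exists j, e j <> 0).
  by case: (@comb_not_coaffine e i j) => //; rewrite /e mulrC subrr.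
suff ce : comb e = 0 by move: De; rewrite ce sub0r => /principalN; rewrite opprK.
rewrite /comb big1 // => j _; suff -> : e j = 0 by rewrite freegU0.
by apply: contrapT => ej; apply: e0; exists j.
Qed.

End Components.

(** * Torsion in the class groups *)

Lemma class_of_eq0 (A : comNzRingType) (D : Div A) : class_of D = 0 <-> principal D.
Proof.
have -> : class_of D = 0 <-> D - 0 \in principal_pred (A := A).
  rewrite Quotient.idealrBE /class_of -(raddf0 (\pi_(Quotient.quot _))).
  by split=> [->|/eqP].
by rewrite subr0; split=> /asboolP.
Qed.

Lemma aclass_of_eq0 (A : comNzRingType) (D : Div A) :
  aclass_of D = 0 <-> affine_trivial D.
Proof.
have -> : aclass_of D = 0 <-> D - 0 \in affine_trivial_pred (A := A).
  rewrite Quotient.idealrBE /aclass_of -(raddf0 (\pi_(Quotient.quot _))).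
  by split=> [->|/eqP].
by rewrite subr0; split=> /asboolP.
Qed.

Theorem theorem4p3 (R : idomainType) (hloc : local_ring R)
    (hnoeth : noetherian_ring R) (hfact : factorial_domain R)
    (r : nat) (U : 'I_r -> R) (hU : forall i, prime_elt (U i))
    (hnonassoc : forall i j, i <> j -> ~ associated (U i) (U j))
    (d : 'I_r -> nat) (hd : forall i, (0 < d i)%N)
    (f : R) (hf : f = \prod_(i < r) U i ^+ d i) :
  (forall D : Div (xy_ring f),
     ((exists2 n : int, n <> 0 & principal (D *~ n)) <-> strongly_coaffine D) /\
     (strongly_coaffine D <-> affine_trivial D)) /\
  (forall c : Cl (xy_ring f),
     Cl_to_AffCl c = 0 <-> exists2 n : int, n <> 0 & c *~ n = 0).
Proof.
have facR := factorial_prime_factorization hfact.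
have f0 : f != 0.
  by rewrite hf; apply/prodf_neq0 => i _; rewrite expf_neq0 //; case: (hU i).
have xyA := xy_ring_presentation f.
have torsionP (D : Div (xy_ring f)) :
    (exists2 n : int, n <> 0 & principal (D *~ n)) <-> strongly_coaffine D.
  split=> [[n n0 nD]|].
    apply: (torsion_strongly_coaffine (xy_domain f0 xyA) (xy_dvr f0 xyA facR) _ n0 nD).
    exact: (xy_dvd_of_local f0 xyA facR).
  (* The type of [D] mentions [f], so the product replaces [f] only as the last argument of the
     presentation. *)
  move: (xyA); rewrite [X in xy_presentation _ _ _ X]hf => xyA'.
  exact: (strongly_coaffine_torsion hU hnonassoc hd xyA' facR hloc).
have trivialP (D : Div (xy_ring f)) : strongly_coaffine D <-> affine_trivial D.
  split=> [/torsionP[n n0 nD] E /torsionP[m m0 mE]|].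
    (* Torsion divisors are closed under sums, since [n * m] serves for both summands. *)
    apply/torsionP; exists (n * m); first by move/eqP; rewrite mulf_eq0 => /orP[]/eqP.
    rewrite mulrzDl; apply: principalD.
      by rewrite mulrzA; exact: principalMz.
    by rewrite mulrC mulrzA; exact: principalMz.
  by move=> tD; rewrite -[D]addr0; apply: tD; exact: strongly_coaffine0.
split=> [D|c]; first by split.
have [D ->] : exists D, c = class_of D by exists (repr c); rewrite /class_of reprK.
rewrite Cl_to_AffClE; have classMz n : class_of D *~ n = class_of (D *~ n).
  by rewrite /class_of raddfMz.
split=> [/aclass_of_eq0/trivialP/torsionP[n n0 nD]|[n n0]].
  by exists n; rewrite // classMz; exact/class_of_eq0.
rewrite classMz => /class_of_eq0 nD.
by apply/aclass_of_eq0/trivialP/torsionP; exists n.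
Qed.
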